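(* Let $\epsilon\in(0,1/2)$, $r\in(2/3,1)$, $c=(1-r)/r$, $\lambda_k=cr^k$ for $k\ge1$, let $\{m_j\}_{j\ge1}$ be an increasing sequence of odd positive integers, and let $P$ be the probability kernel on $A=\{-1,+1\}$ given by $$P(+1|\underline{x})=\sum_{k\ge1}\lambda_k\,\phi\left(\frac1{m_k}\sum_{i=1}^{m_k}x_{-i}\right),\qquad \phi(t)=(1-\epsilon){\bf 1}\{t>0\}+\epsilon{\bf 1}\{t<0\},$$ and $P(-1|\underline{x})=1-P(+1|\underline{x})$ (the original BK example). Then there exists a unique stationary chain compatible with $P$ if and only if there is a stationary chain compatible with $P$ that is a finitary coding of a finite alphabet i.i.d. process.
   Context: A past is $\underline{x}=x_{-1}x_{-2}\ldots\in A^{-\mathbb{N}}$. A stationary chain $\{X_j\}_{j\in\mathbb{Z}}$ on $A$ with law $\mu$ is compatible with $P$ if $\mu(X_0=a|X_{-\infty}^{-1}=\underline{x})=P(a|\underline{x})$ for every $a\in A$ and $\mu$-a.e. $\underline{x}$. Uniqueness refers to the law of the stationary chain. Finitary coding. Let ${\bf U}=\{U_i\}_{i\in\mathbb{Z}}$ be an i.i.d. process with values in a set $\mathcal{U}$ and law $\mathbb{P}$. A stationary process ${\bf X}$ on $A$ with law $\mu$ is a finitary coding of ${\bf U}$ if there is a measurable $\Phi:\mathcal{U}^{\mathbb{Z}}\to A^{\mathbb{Z}}$ commuting with the shifts, with $\mu=\mathbb{P}\circ\Phi^{-1}$, and there are $\mathbb{P}$-a.s. finite $\theta_1,\theta_2:\mathcal{U}^{\mathbb{Z}}\to\mathbb{N}\cup\{\infty\}$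 ($0$ allowed) such that $\{\theta_1({\bf U})=k\}\cap\{\theta_2({\bf U})=l\}$ is measurable with respect to $\sigma(U_{-k},\ldots,U_l)$ for all finite $k,l$, and $[\Phi({\bf U})]_0=[\Phi({\bf V})]_0$ whenever ${\bf U}$ and ${\bf V}$ agree on all coordinates from $-\theta_1({\bf U})$ to $\theta_2({\bf U})$. It is a finitary coding of a finite alphabet i.i.d. process if $\mathcal{U}$ can be taken finite. *)

(* Defs.v *)
From HB Require Import structures.
From mathcomp Require Import all_boot all_order all_algebra.
From mathcomp Require Import all_classical all_reals all_analysis.

Set Implicit Arguments.
Unset Strict Implicit.
Unset Printing Implicit Defensive.

Import Order.TTheory GRing.Theory Num.Theory.
Import numFieldNormedType.Exports.

Local Open Scope classical_set_scope.
Local Open Scope ring_scope.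

(* The events {x : x i \in B}, for i \in D and B measurable; the sigma-algebra
   generated by the coordinates in D is <<s coord_events T D >>. *)
Definition coord_events (I : Type) {d : measure_display} (T : measurableType d)
    (D : set I) : set_system (I -> T) :=
  \bigcup_(i in D) preimage_set_system setT (fun x : I -> T => x i) measurable.
Arguments coord_events {I d} T D.

(* T^I with the product sigma-algebra *)
Notation prod_space I T := (g_sigma_algebraType (coord_events T [set: I])).

Section iid.
Context {d : measure_display} {U : measurableType d} {R : realType}.

Definition identically_distributed (P : probability (prod_space int U) R) :=
  forall (i j : int) (B : set U), measurable B ->
    P [set u | B (u i)] = P [set u | B (u j)].

Definition mutually_independent (P : probability (prod_space int U) R) :=
  forall (s : seq int) (B : int -> set U), uniq s ->
    (forall i, measurable (B i)) ->
    P [set u | forall i, i \in s -> B i (u i)]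
    = (\prod_(i <- s) P [set u | B i (u i)])%E.

(* P, a law on U^Z, is the law of an i.i.d. process *)
Definition iid (P : probability (prod_space int U) R) :=
  identically_distributed P /\ mutually_independent P.

End iid.

Definition shiftZ (T : Type) (x : int -> T) : int -> T := fun i => x (i + 1).

(* The alphabet {-1, +1} is represented by bool. *)
Definition spin {R : realType} (b : bool) : R := if b then 1 else -1.

Notation config := (prod_space int bool).

(* A past y : nat -> bool is indexed so that y n stands for x_{-(n+1)}. *)
Notation past := (prod_space nat bool).

Definition past_of (x : config) : past := fun n => x (- n.+1%:Z).

Section chains.
Context {R : realType}.

(* Processes are represented by their laws on {-1,+1}^Z. *)
Definition stationary (mu : probability config R) :=
  forall B : set config, measurable B -> mu (@shiftZ bool @^-1` B) = mu B.

(* g is a version of y |-> mu(X_0 = a | X_{-oo}^{-1} = y) *)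
Definition cond_prob_given_past (mu : probability config R) (a : bool)
    (g : past -> R) :=
  measurable_fun setT g /\
  forall B : set past, measurable B ->
    mu ([set x : config | x 0 = a] `&` past_of @^-1` B)
    = (\int[mu]_(x in past_of @^-1` B) (g (past_of x))%:E)%E.

Definition compatible (P : bool -> past -> R) (mu : probability config R) :=
  forall a : bool, cond_prob_given_past mu a (P a).

(* Laws are compared on measurable sets only: the value of a measure of the
   library at a non-measurable set is unspecified. *)
Definition unique_stationary_chain (P : bool -> past -> R) :=
  exists mu : probability config R,
    [/\ stationary mu, compatible P mu &
        forall nu : probability config R, stationary nu -> compatible P nu ->
          forall B : set config, measurable B -> nu B = mu B].

End chains.

(* The integers between -t1 and t2, where None stands for infinity *)
Definition window (t1 t2 : option nat) : set int :=
  [set i | (if t1 is Some k then - k%:Z <= i else true) &&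
           (if t2 is Some l then i <= l%:Z else true)].

Definition finitary_coding {R : realType} {d : measure_display}
    {U : measurableType d} (P : probability (prod_space int U) R)
    (mu : probability config R) :=
  exists (Phi : prod_space int U -> config)
         (theta1 theta2 : prod_space int U -> option nat),
  [/\ measurable_fun setT Phi,
      (forall u, Phi (shiftZ u) = shiftZ (Phi u)),
      (forall B : set config, measurable B -> mu B = P (Phi @^-1` B)),
      {ae P, forall u, theta1 u != None} /\ {ae P, forall u, theta2 u != None} &
      (forall k l : nat,
        <<s coord_events U (window (Some k) (Some l)) >>
          ([set u | theta1 u = Some k] `&` [set u | theta2 u = Some l])) /\
      (forall u v : prod_space int U,
        (forall i, window (theta1 u) (theta2 u) i -> u i = v i) ->
        Phi u 0 = Phi v 0)].

Definition finitary_coding_of_finite_iid {R : realType}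
    (mu : probability config R) :=
  exists (d : measure_display) (U : measurableType d)
         (P : probability (prod_space int U) R),
  [/\ finite_set [set: U], (forall B : set U, measurable B), iid P &
      finitary_coding P mu].

Section BK.
Context {R : realType}.

Definition BK_phi (eps t : R) : R :=
  (1 - eps) * (0 < t)%R%:R + eps * (t < 0)%R%:R.

Definition BK_lambda (r : R) (k : nat) : R := (1 - r) / r * r ^+ k.

(* m is indexed from 1: m 0 is not used *)
Definition BK_plus (eps r : R) (m : nat -> nat) (y : past) : R :=
  \big[+%R/0]_(1 <= k <oo)
    (BK_lambda r k *
     BK_phi eps ((m k)%:R^-1 * \sum_(1 <= i < (m k).+1) spin (y i.-1))).

Definition BK_kernel (eps r : R) (m : nat -> nat) (a : bool) (y : past) : R :=
  if a then BK_plus eps r m y else 1 - BK_plus eps r m y.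

End BK.

(* Main.v *)
From HB Require Import structures.
Require Import Defs.
From mathcomp Require Import all_boot all_order all_algebra.
From mathcomp Require Import all_classical all_reals all_analysis.
From mathcomp Require Import measurable_realfun.
From mathcomp Require Import ring lra zify.

Set Implicit Arguments.
Unset Strict Implicit.
Unset Printing Implicit Defensive.

Import Order.TTheory GRing.Theory Num.Theory.
Import numFieldNormedType.Exports.

Local Open Scope classical_set_scope.
Local Open Scope ring_scope.

(** Two ideas carry the proof, one for each direction.

    A finitary coding implies uniqueness. The kernel P takes values in
    [eps, 1 - eps] and is uniformly continuous in the past, so the probabilities
    of a word of length n under two compatible chains mu and nu differ by a factor
    exp o(n) (cylinder_comparison). If mu is a finitary coding of an i.i.d.
    sequence, an event on finitely many symbols is covered, up to a small
    probability, by an event on finitely many letters (local_cover). Its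
    occurrences in disjoint blocks are then dominated by independent events and
    concentrate exponentially fast around the mean under mu; by the comparison, nu
    cannot have a larger mean (local_event_le). Hence nu = mu on local events, and
    everywhere.

    Uniqueness implies a finitary coding. Since the votes are never tied, P is a
    mixture of monotone updates: with probability eps write +1, with probability
    eps write -1, and otherwise follow the majority of a window with geometric
    number (BK_phiE). Given independent update instructions at all sites, the
    simulations started in the remote past from the constant pasts +1 and -1 are
    monotone in their starting time. Their limits are stationary chains compatible
    with P (limit_compatible), as P is continuous. If the chain is unique, these
    limits have the same law; being ordered, they coincide almost surely. The
    symbol of a site is then fixed by finitely many instructions, those for which
    the two extremal simulations agree (coalescence_determines).

    The instructions take infinitely many values, and have to be coded in their
    turn by a finite alphabet. Each letter carries a symbol to write or a geometric
    number truncated at N, and a coin which is false with probability r. A site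
    whose number exceeds N needs further coins, which it takes from later sites; the sites in need form a
    stack, and each coin goes to the most recent one. For N large, requests arrive
    more slowly than they are satisfied, so that every search ends almost surely
    (ae_completed). The conditional probability that the searches of given sites
    have given outcomes is a martingale, a product over the sites of which a new
    letter affects one factor at a time, because the geometric distribution is
    memoryless (total_value_step); hence the instructions are independent with
    the right law (pr_updates). The i.i.d. sequence of letters itself is read off
    the expansion of a uniform point of [0, 1[ (iid_exists). *)

(** * Sequences over a finite alphabet *)

Lemma measurable_fun_coord {d d' : measure_display} {Om : measurableType d}
    {T : measurableType d'} (I : Type) (f : Om -> prod_space I T) :
  (forall i (B : set T), measurable B -> measurable [set u | B (f u i)]) ->
  measurable_fun setT f.
Proof.
move=> mf.
apply: (@measurability _ _ Om (prod_space I T) setT f (coord_events T [set: I])).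
  by [].
by move=> _ [_ [i _ [B mB <-]] <-]; rewrite !setTI; exact: mf.
Qed.

Section finite_alphabet.
Context {d : measure_display} {T : measurableType d} (s : seq T).
Hypothesis s_all : forall t : T, t \in s.
Hypothesis mT : forall B : set T, measurable B.

Lemma measurable_coord_in (I : Type) (D : set I) (i : I) (B : set T) : D i ->
  measurable ([set x | B (x i)] : set (g_sigma_algebraType (coord_events T D))).
Proof.
move=> Di; apply: sub_sigma_algebra; exists i => //; exists B; first exact: mT.
by rewrite setTI.
Qed.

(** Finiteness of the alphabet makes every event that depends on finitely many
    coordinates a finite union of cylinders. *)
Lemma measurable_trace_in (I : eqType) (D : set I) (l : seq I) (S : set (seq T)) :
  (forall i, i \in l -> D i) ->
  measurable ([set x : I -> T | S (map x l)] :
    set (g_sigma_algebraType (coord_events T D))).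
Proof.
elim: l S => [|i l IH] S lD.
  have [S0|S0] := pselect (S [::]).
    have -> : [set x : I -> T | S (map x [::])] = setT.
      by apply/seteqP; split.
    exact: measurableT.
  have -> : [set x : I -> T | S (map x [::])] = set0.
    by apply/seteqP; split.
  exact: measurable0.
rewrite (_ : [set x | _] =
  \bigcup_(t in [set` s])
     ([set x : I -> T | [set t] (x i)] `&`
      [set x : I -> T | [set w | S (t :: w)] (map x l)])).
  apply: fin_bigcup_measurable => // t _.
  apply: measurableI; first by apply: measurable_coord_in; exact: lD (mem_head i l).
  by apply: IH => j jl; apply: lD; rewrite in_cons jl orbT.
apply/seteqP; split => [x Sx|x [t _ [/= <-]]//].
by exists (x i) => //=; exact: s_all.
Qed.

Lemma measurable_coord (I : Type) (i : I) (B : set T) :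
  measurable ([set x | B (x i)] : set (prod_space I T)).
Proof. exact: measurable_coord_in. Qed.

Lemma measurable_trace (I : eqType) (l : seq I) (S : set (seq T)) :
  measurable ([set x : I -> T | S (map x l)] : set (prod_space I T)).
Proof. exact: measurable_trace_in. Qed.

(** The events that depend on finitely many coordinates form a pi-system that
    generates the product sigma-algebra. *)
Lemma measure_trace_ext (I : eqType) (R : realType)
    (m1 m2 : {measure set (prod_space I T) -> \bar R}) :
  (m1 setT < +oo)%E ->
  (forall (l : seq I) (S : set (seq T)),
     m1 [set x : I -> T | S (map x l)] = m2 [set x : I -> T | S (map x l)]) ->
  forall B : set (prod_space I T), measurable B -> m1 B = m2 B.
Proof.
move=> m1T m12 B mB.
pose G : set (set (prod_space I T)) :=
  [set A | exists (l : seq I) (S : set (seq T)), A = [set x : I -> T | S (map x l)]].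
have GT : G setT by exists [::], setT.
apply: (@g_sigma_algebra_measure_unique _ _ _ G _ (fun=> setT)) => //.
- by move=> A [l [S ->]]; exact: measurable_trace.
- by rewrite bigcup_const.
- move=> A1 A2 [l1 [S1 ->]] [l2 [S2 ->]]; exists (l1 ++ l2).
  exists [set w | S1 (take (size l1) w) /\ S2 (drop (size l1) w)].
  apply/seteqP; split => x /=; rewrite map_cat ?take_cat ?drop_cat size_map;
    rewrite ltnn subnn take0 drop0 cats0 //.
- by move=> A [l [S ->]]; exact: m12.
move: B mB; apply: smallest_sub.
  exact: smallest_sigma_algebra.
move=> _ [i _ [B _ <-]]; apply: sub_sigma_algebra.
by exists [:: i], [set w | forall t, w = [:: t] -> B t]; rewrite setTI;
  apply/seteqP; split => x /= => [Bx t [<-]//|]; apply.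
Qed.

Fixpoint words n : seq (seq T) :=
  if n is n'.+1 then [seq x :: w | x <- s, w <- words n'] else [:: [::]].

Lemma mem_words n w : (w \in words n) = (size w == n).
Proof.
elim: n w => [|n IH] [|x w] //=.
  by apply/negbTE/negP => /allpairsP[[y v] [_ _]].
rewrite eqSS -IH; apply/allpairsP/idP => [[[y v] /= [_ vn [_ ->]]]//|wn].
by exists (x, w).
Qed.

Lemma words_uniq n : uniq s -> uniq (words n).
Proof.
move=> us; elim: n => [|n IH] //=.
by apply: allpairs_uniq => // -[x v] [y w] _ _ /= [-> ->].
Qed.

Lemma sum_wordsS (V : nmodType) n (F : seq T -> V) :
  \sum_(w <- words n.+1) F w = \sum_(x <- s) \sum_(w <- words n) F (x :: w).
Proof. by rewrite /= big_allpairs_dep. Qed.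

Lemma sum_words_rcons (V : nmodType) n (F : seq T -> V) :
  \sum_(w <- words n.+1) F w = \sum_(w <- words n) \sum_(x <- s) F (rcons w x).
Proof.
elim: n F => [|n IH] F; last first.
  rewrite sum_wordsS.
  under eq_bigr => x _ do rewrite IH.
  by rewrite [in RHS]sum_wordsS.
rewrite sum_wordsS /= big_seq1; apply: eq_bigr => x _.
by rewrite big_seq1.
Qed.


Lemma sum_words_cat (V : nmodType) n m (F : seq T -> V) :
  \sum_(w <- words (n + m)) F w =
  \sum_(w <- words n) \sum_(v <- words m) F (w ++ v).
Proof.
elim: n F => [|n IH] F; first by rewrite /= big_seq1.
rewrite addSn !sum_wordsS; apply: eq_bigr => x _; exact: IH.
Qed.

End finite_alphabet.

Section windows.
Context {T : Type}.

Definition interval_from (a : int) (n : nat) : seq int :=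
  [seq a + i%:Z | i <- iota 0 n].

Definition word (a : int) (n : nat) (u : int -> T) : seq T :=
  map u (interval_from a n).

Lemma size_word a n u : size (word a n u) = n.
Proof. by rewrite !size_map size_iota. Qed.

Lemma nth_word x0 a n u k : (k < n)%N -> nth x0 (word a n u) k = u (a + k%:Z).
Proof.
move=> kn; rewrite (nth_map 0) ?size_map ?size_iota//.
by rewrite (nth_map 0%N) ?size_iota// nth_iota.
Qed.

Lemma mem_interval_from a n i : (i \in interval_from a n) = (a <= i < a + n%:Z).
Proof.
apply/mapP/andP => [[k]|[ai ian]].
  by rewrite mem_iota => kn ->; split; lia.
exists (absz (i - a)); last lia.
by rewrite mem_iota; lia.
Qed.

Lemma interval_from_cat a n m :
  interval_from a (n + m) = interval_from a n ++ interval_from (a + n%:Z) m.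
Proof.
rewrite /interval_from iotaD map_cat; congr cat.
rewrite add0n -[n in iota n]addn0 iotaDl -map_comp; apply: eq_map => i /=.
by rewrite PoszD addrA.
Qed.

Lemma word_cat a n m u : word a (n + m) u = word a n u ++ word (a + n%:Z) m u.
Proof. by rewrite /word interval_from_cat map_cat. Qed.

Lemma wordS a n u : word a n.+1 u = u a :: word (a + 1) n u.
Proof. by rewrite -add1n word_cat /word /= addr0. Qed.

Lemma word_rcons a n u : word a n.+1 u = rcons (word a n u) (u (a + n%:Z)).
Proof. by rewrite -addn1 word_cat /word /= addr0 cats1. Qed.

Definition shift_by (b : int) (u : int -> T) : int -> T := fun i => u (i + b).

Lemma shift_by1 : shift_by 1 = @shiftZ T.
Proof. by []. Qed.

Lemma word_shift_by a b n u : word a n (shift_by b u) = word (a + b) n u.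
Proof.
rewrite /word /interval_from -!map_comp; apply: eq_map => i /=.
by rewrite /shift_by; congr u; lia.
Qed.

Lemma word_shiftZ a n u : word a n (shiftZ u) = word (a + 1) n u.
Proof. by rewrite -shift_by1 word_shift_by. Qed.

Lemma shift_by_iter (n : nat) u : shift_by n%:Z u = iter n (@shiftZ T) u.
Proof.
elim: n => [|n IH]; first by apply/funext => i; rewrite /shift_by addr0.
by rewrite iterS -IH; apply/funext => i; rewrite /shift_by /shiftZ; congr u; lia.
Qed.

Lemma shift_byK (a : int) u : shift_by a (shift_by (- a) u) = u.
Proof. by apply/funext => i; rewrite /shift_by addrK. Qed.

Lemma shift_byNK (a : int) u : shift_by (- a) (shift_by a u) = u.
Proof. by apply/funext => i; rewrite /shift_by subrK. Qed.

Lemma eq_word a n u v :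
  (forall i, a <= i < a + n%:Z -> u i = v i) -> word a n u = word a n v.
Proof.
by move=> uv; apply/eq_in_map => i; rewrite mem_interval_from; exact: uv.
Qed.

Lemma word_inj a n u v i :
  word a n u = word a n v -> a <= i < a + n%:Z -> u i = v i.
Proof. by move/eq_in_map => uv ain; apply: uv; rewrite mem_interval_from. Qed.

Lemma take_word a n m u : (m <= n)%N -> take m (word a n u) = word a m u.
Proof.
by move=> mn; rewrite -(subnKC mn) word_cat take_size_cat ?size_word.
Qed.

Lemma drop_word a n m u :
  drop m (word a (m + n) u) = word (a + m%:Z) n u.
Proof. by rewrite word_cat drop_size_cat ?size_word. Qed.

End windows.

Section integrals.
Context {d' : measure_display} {R : realType}
  {Om : measurableType d'} (P : probability Om R).

Definition pr (A : set Om) : R := fine (P A).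

Lemma prE A : measurable A -> P A = (pr A)%:E.
Proof. by move=> mA; rewrite fineK// fin_num_measure. Qed.

Lemma pr_ge0 A : 0 <= pr A.
Proof. by rewrite fine_ge0. Qed.

Lemma pr_le A B : measurable A -> measurable B -> A `<=` B -> pr A <= pr B.
Proof.
by move=> mA mB AB; rewrite -lee_fin -!prE// le_measure// inE.
Qed.

Lemma pr_setT : pr setT = 1.
Proof. by rewrite /pr probability_setT. Qed.

Lemma pr_setC A : measurable A -> pr (~` A) = 1 - pr A.
Proof.
move=> mA; apply: EFin_inj; rewrite EFinB -!prE//; first exact: probability_setC.
exact: measurableC.
Qed.

Lemma pr_setU_le A B : measurable A -> measurable B ->
  pr (A `|` B) <= pr A + pr B.
Proof.
move=> mA mB; rewrite -lee_fin EFinD -!prE//; last exact: measurableU.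
exact: measureU2.
Qed.

Lemma integral_finite_valued (W : eqType) (l : seq W) (X : Om -> W)
    (F : W -> R) :
  uniq l -> (forall u, X u \in l) -> (forall w, 0 <= F w) ->
  (forall w, measurable [set u | X u = w]) ->
  (\int[P]_u (F (X u))%:E = (\sum_(w <- l) F w * pr [set u | X u = w])%:E)%E.
Proof.
move=> ul Xl F0 mX.
have FX u : (F (X u))%:E = (\sum_(w <- l) (F w)%:E * (\1_[set u | X u = w] u)%:E)%E.
  rewrite (bigD1_seq (X u))//= indicE mem_set// mule1 big1_seq ?adde0//.
  move=> w /andP[wX _]; rewrite indicE memNset ?mule0//= => /esym wE.
  by rewrite wE eqxx in wX.
under eq_integral => u _ do rewrite FX.
have mI w : measurable_fun setT (EFin \o (\1_[set u | X u = w] : Om -> R)).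
  by apply/measurable_EFinP; exact: measurable_indic.
rewrite ge0_integral_sum//; last 2 first.
- by move=> w; apply: (emeasurable_funM _ (mI w)); exact: measurable_cst.
- by move=> w u _; rewrite mule_ge0// lee_fin.
rewrite -sumEFin; apply: eq_bigr => w _.
by rewrite (ge0_integralZl_EFin P measurableT _ (mI w))//= integral_indic// setIT EFinM -prE.
Qed.

Lemma measurable_finite_valued (W : eqType) (l : seq W) (X : Om -> W)
    (S : set W) :
  (forall u, X u \in l) -> (forall w, measurable [set u | X u = w]) ->
  measurable [set u | S (X u)].
Proof.
move=> Xl mX.
rewrite (_ : [set u | _] =
  \bigcup_(w in [set` l] `&` S) [set u | X u = w]); last first.
  by apply/seteqP; split => [u Su|u [w [_ Sw] /= ->]//]; exists (X u) => //=.
by apply: fin_bigcup_measurable => //; exact: finite_setIl.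
Qed.

Lemma measurable_fun_finite_valued (W : eqType) (l : seq W) (X : Om -> W)
    (F : W -> R) :
  (forall u, X u \in l) -> (forall w, measurable [set u | X u = w]) ->
  measurable_fun setT (fun u => F (X u)).
Proof.
move=> Xl mX _ Y mY; rewrite setTI.
exact: (measurable_finite_valued [set w | Y (F w)] Xl mX).
Qed.

Lemma pr_finite_valued (W : eqType) (l : seq W) (X : Om -> W) (S : set W) :
  uniq l -> (forall u, X u \in l) ->
  (forall w, measurable [set u | X u = w]) ->
  pr [set u | S (X u)] = \sum_(w <- l) (`[< S w >])%:R * pr [set u | X u = w].
Proof.
move=> ul Xl mX; apply: EFin_inj.
rewrite -(integral_finite_valued (F := fun w => (`[< S w >])%:R))//.
have mS := measurable_finite_valued S Xl mX.
by rewrite -prE// -[X in P X]setIT -integral_indic.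
Qed.

End integrals.

Lemma pr_eq {d d' : measure_display} {R : realType} {T : measurableType d}
    {T' : measurableType d'} (P : probability T R) (Q : probability T' R) A B :
  measurable A -> measurable B -> pr P A = pr Q B -> P A = Q B.
Proof. by move=> mA mB PQ; rewrite (prE P mA) (prE Q mB) PQ. Qed.

Section image_law.
Context {d d' : measure_display} {R : realType} {T : measurableType d}
  {T' : measurableType d'} (P : probability T R) (f : T -> T').
Hypothesis mf : measurable_fun setT f.

Definition image_law : probability T' R := distribution P (mfun_Sub (mem_set mf)).

Lemma image_lawE A : image_law A = P (f @^-1` A).
Proof. by []. Qed.

End image_law.

Section iid_words.
Context {d : measure_display} {T : measurableType d} {R : realType} (s : seq T).
Hypothesis s_uniq : uniq s.
Hypothesis s_all : forall t : T, t \in s.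
Hypothesis mT : forall B : set T, measurable B.
Local Notation space := (prod_space int T).

Lemma measurable_word a n (S : set (seq T)) :
  measurable ([set u | S (word a n u)] : set space).
Proof. exact: (measurable_trace s_all mT). Qed.

Lemma word_in_words a n (u : int -> T) : word a n u \in words s n.
Proof. by rewrite mem_words// size_word. Qed.

Lemma integral_word (P : probability space R) a n (F : seq T -> R) :
  (forall w, 0 <= F w) ->
  (\int[P]_u (F (word a n u))%:E =
   (\sum_(w <- words s n) F w * pr P [set u | word a n u = w])%:E)%E.
Proof.
move=> F0; apply: (integral_finite_valued P (X := word a n)) => //.
- exact: words_uniq.
- exact: word_in_words.
- by move=> w; exact: (measurable_word a n [set w]).
Qed.

Lemma pr_word (P : probability space R) a n (S : set (seq T)) :
  pr P [set u | S (word a n u)] =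
  \sum_(w <- words s n) (`[< S w >])%:R * pr P [set u | word a n u = w].
Proof.
apply: (pr_finite_valued P (X := word a n)).
- exact: words_uniq.
- exact: word_in_words.
- by move=> w; exact: (measurable_word a n [set w]).
Qed.

Lemma measurable_fun_word (F : seq T -> R) a n :
  measurable_fun [set: space] (fun u => F (word a n u)).
Proof.
apply: (measurable_fun_finite_valued (Om := space) (l := words s n)).
- exact: word_in_words.
- by move=> w; exact: (measurable_word a n [set w]).
Qed.

(** Every finite set of sites lies in an interval. *)
Lemma measure_word_ext (m1 m2 : {measure set space -> \bar R}) :
  (m1 setT < +oo)%E ->
  (forall a n (S : set (seq T)),
     m1 [set u | S (word a n u)] = m2 [set u | S (word a n u)]) ->
  forall B : set space, measurable B -> m1 B = m2 B.
Proof.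
move=> m1T m12; apply: (measure_trace_ext s_all mT m1T) => l S.
pose n := \max_(i <- l) `|i|%N.
have ln i : i \in l -> (`|i| <= n)%N by move=> il; rewrite /n (leq_bigmax_seq _ il).
have lE (u : int -> T) : map u l =
    [seq nth point (word (- n%:Z) (n + n).+1 u) (absz (i + n%:Z)) | i <- l].
  apply/eq_in_map => i /ln iln; rewrite nth_word; last lia.
  by congr u; lia.
pose S' := [set w | S [seq nth point w (absz (i + n%:Z)) | i <- l]].
rewrite (_ : [set x : int -> T | S (map x l)] = [set u | S' (word (- n%:Z) (n + n).+1 u)]).
  exact: m12.
by apply/seteqP; split => u /= Su; [rewrite /S' /= -lE|rewrite lE].
Qed.

Lemma pr_word_ext (P Q : probability space R) :
  (forall a n w, pr P [set u | word a n u = w] = pr Q [set u | word a n u = w]) ->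
  forall B : set space, measurable B -> P B = Q B.
Proof.
move=> PQ; apply: measure_word_ext => [|a n S].
  exact: (le_lt_trans (probability_le1 P measurableT) (ltry 1)).
apply: (@pr_eq _ _ _ _ _ P Q); [exact: measurable_word..|].
by rewrite !pr_word; apply: eq_bigr => w _; rewrite PQ.
Qed.

Section iid_law.
Variable P : probability space R.

Definition letter_prob (t : T) : R := pr P [set u | u 0 = t].

Definition word_prob (p : T -> R) (w : seq T) : R := \prod_(x <- w) p x.

Hypothesis P_iid : iid P.

Lemma iid_word a n w : size w = n ->
  pr P [set u | word a n u = w] = word_prob letter_prob w.
Proof.
move=> wn; have [Pid Pind] := P_iid.
pose B (i : int) : set T := [set nth point w (absz (i - a))].
have -> : [set u | word a n u = w] =
    [set u : int -> T | forall i, i \in interval_from a n -> B i (u i)].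
  apply/seteqP; split => u /= => [wE i|uB].
    rewrite mem_interval_from => ian; rewrite /B /= -wE nth_word; last lia.
    by congr u; lia.
  apply: (@eq_from_nth _ point); rewrite size_word// => k kn.
  rewrite nth_word// (uB (a + k%:Z)) ?mem_interval_from; last lia.
  by congr nth; lia.
apply: EFin_inj; rewrite -prE; last first.
  rewrite (_ : [set u | _] = [set u | (fun v =>
      forall k, (k < n)%N -> nth point v k = nth point w k) (word a n u)]).
    exact: (measurable_word a n (fun v => forall k, (k < n)%N -> nth point v k = nth point w k)).
  apply/seteqP; split => u /= uB.
    move=> k kn; rewrite nth_word// uB ?mem_interval_from; last lia.
    by congr nth; lia.
  move=> i; rewrite mem_interval_from => ian; rewrite /B /=.
  rewrite -uB ?nth_word; [congr u|..]; lia.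
rewrite Pind//; last first.
  rewrite /interval_from map_inj_uniq ?iota_uniq// => i j /addrI [].
  exact.
rewrite /interval_from big_map /word_prob.
rewrite -[w in RHS](mkseq_nth point w) big_map wn -prodEFin.
apply: eq_bigr => k _.
rewrite (Pid (a + k%:Z) 0 _ (mT _)) (prE P (measurable_coord mT 0 _)).
have -> : B (a + k%:Z) = [set nth point w k].
  by rewrite /B; congr [set nth _ _ _]; lia.
by [].
Qed.

Lemma measurable_shift_by (b : int) :
  measurable_fun [set: space] (@shift_by T b : space -> space).
Proof.
by apply: measurable_fun_coord => i C _; exact: (measurable_coord mT (i + b)).
Qed.

(** Both laws give a word its product probability. *)
Lemma iid_shift_by (b : int) (B : set space) : measurable B ->
  P (@shift_by T b @^-1` B) = P B.
Proof.
rewrite -(image_lawE P (measurable_shift_by b)); apply: pr_word_ext => a n w.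
have -> : pr (image_law P (measurable_shift_by b)) [set u | word a n u = w] =
    pr P [set u | word (a + b) n u = w].
  congr (fine (P _)).
  by apply/seteqP; split => u /=; rewrite word_shift_by.
have [wn|wn] := eqVneq (size w) n; first by rewrite !iid_word.
congr (fine (P _)); apply/seteqP.
by split => u /= uw; rewrite -uw size_word eqxx in wn.
Qed.

End iid_law.
End iid_words.

(** * The kernel *)

Section kernel.
Context {R : realType}.
Variables (eps r : R) (m : nat -> nat).
Hypothesis heps : 0 < eps < 1 / 2.
Hypothesis hr : 0 < r < 1.
Hypothesis m_odd : forall j : nat, (1 <= j)%N -> odd (m j).
Hypothesis m_incr : forall i j : nat, (1 <= i)%N -> (i < j)%N -> (m i < m j)%N.

Definition majority (k : nat) (y : nat -> bool) : bool :=
  0 < \sum_(1 <= i < (m k).+1) spin (y i.-1) :> R.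

(** Counting the +1 spins shows that the sum has the parity of the number of
    votes. *)
Lemma sum_spin n (y : nat -> bool) :
  \sum_(1 <= i < n.+1) spin (y i.-1) =
  (\sum_(0 <= i < n) y i)%N%:R *+ 2 - n%:R :> R.
Proof.
rewrite big_add1 /=; elim: n => [|n IH]; first by rewrite !big_nil mul0rn subr0.
rewrite big_nat_recr//= IH big_nat_recr//= natrD.
by case: (y n) => /=; rewrite -natr1; ring.
Qed.

Lemma sum_spin_neq0 k (y : nat -> bool) : (1 <= k)%N ->
  \sum_(1 <= i < (m k).+1) spin (y i.-1) != 0 :> R.
Proof.
move=> k1; rewrite sum_spin subr_eq0 -mulrnA eqr_nat; apply/eqP => mE.
by have := m_odd k1; rewrite -mE oddM andbF.
Qed.

(** An odd number of votes is never tied. Hence the new symbol is +1 with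
    probability eps, -1 with probability eps, and otherwise the majority symbol:
    a random choice between nondecreasing functions of the past, although the
    rule that flips the majority with probability eps is not one. *)
Lemma BK_phiE k (y : nat -> bool) : (1 <= k)%N ->
  BK_phi eps ((m k)%:R^-1 * \sum_(1 <= i < (m k).+1) spin (y i.-1)) =
  eps + (1 - 2 * eps) * (majority k y)%:R.
Proof.
move=> k1; rewrite /BK_phi.
have mk : 0 < (m k)%:R :> R by rewrite ltr0n; case: (m k) (m_odd k1).
rewrite pmulr_rgt0 ?invr_gt0// pmulr_rlt0 ?invr_gt0// -/(majority k y).
have := sum_spin_neq0 y k1; rewrite /majority.
by case: ltgtP => //= _ _; ring.
Qed.

Lemma majority_mono k (y y' : nat -> bool) :
  (forall i, y i ==> y' i) -> majority k y ==> majority k y'.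
Proof.
move=> yy'; apply/implyP => /lt_le_trans; apply; apply: ler_sum => i _.
by have := yy' i.-1; case: (y i.-1); case: (y' i.-1) => //= _.
Qed.

Lemma eq_majority k (y y' : nat -> bool) :
  (forall i, (i < m k)%N -> y i = y' i) -> majority k y = majority k y'.
Proof.
move=> yy'; rewrite /majority; congr (_ < _).
apply: eq_big_nat => i /andP[i1 im].
by rewrite yy'//; case: i i1 im.
Qed.

(** The probability that the majority is +1 in a window whose geometric number is
    conditioned to exceed j. *)
Definition maj_prob (j : nat) (y : nat -> bool) : R :=
  limn (series (fun k => (1 - r) * r ^+ k * (majority (j + k).+1 y)%:R)).

Lemma maj_prob_partial j y n :
  0 <= series (fun k => (1 - r) * r ^+ k * (majority (j + k).+1 y)%:R) n
    <= 1 - r ^+ n.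
Proof.
case/andP: hr => r0 r1.
elim: n => [|n]; first by rewrite /series /= big_nil expr0 subrr lexx.
rewrite /series /= big_nat_recr//= exprS => /andP[S0 S1].
set S := \sum_(0 <= k < n) _ in S0 S1 *.
have rn : 0 < r ^+ n by rewrite exprn_gt0.
have q : 0 <= (1 - r) * r ^+ n by rewrite mulr_ge0 ?ltW ?subr_gt0.
by case: (majority _ y) => /=; apply/andP; split; rewrite ?mulr1 ?mulr0; lra.
Qed.

Lemma is_cvg_maj_prob j y :
  cvgn (series (fun k => (1 - r) * r ^+ k * (majority (j + k).+1 y)%:R)).
Proof.
case/andP: hr => r0 r1.
apply: nondecreasing_is_cvgn.
  apply: nondecreasing_series => k _ _.
  by rewrite !mulr_ge0 ?ler0n ?exprn_ge0 ?subr_ge0 ?ltW.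
exists 1 => _ [n _ <-].
have /andP[_ /le_trans] := maj_prob_partial j y n; apply.
by rewrite gerBl exprn_ge0// ltW.
Qed.

Lemma maj_prob_bounds j y : 0 <= maj_prob j y <= 1.
Proof.
case/andP: hr => r0 r1.
apply/andP; split.
  apply: limr_ge; first exact: is_cvg_maj_prob.
  by apply: nearW => n; case/andP: (maj_prob_partial j y n).
apply: limr_le; first exact: is_cvg_maj_prob.
apply: nearW => n; have /andP[_ /le_trans] := maj_prob_partial j y n; apply.
by rewrite gerBl exprn_ge0// ltW.
Qed.

(** The geometric distribution is memoryless. *)
Lemma maj_probS j y :
  maj_prob j y = (1 - r) * (majority j.+1 y)%:R + r * maj_prob j.+1 y.
Proof.
rewrite /maj_prob; apply/cvg_lim => //.
rewrite -(cvg_shiftS (series _)) /=.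
have -> : (fun n => series
    (fun k => (1 - r) * r ^+ k * (majority (j + k).+1 y)%:R) n.+1) =
  (fun n => (1 - r) * (majority j.+1 y)%:R + r * series
    (fun k => (1 - r) * r ^+ k * (majority (j.+1 + k).+1 y)%:R) n).
  apply/funext => n; rewrite /series /= big_nat_recl//= expr0 mulr1 addn0.
  congr +%R; rewrite mulr_sumr; apply: eq_bigr => k _.
  by rewrite exprS addSnnS; ring.
apply: cvgD; first exact: cvg_cst.
by apply: cvgMr; exact: is_cvg_maj_prob.
Qed.

Lemma maj_prob_iter j n y : maj_prob j y =
  \sum_(k < n) (1 - r) * r ^+ k * (majority (j + k).+1 y)%:R
  + r ^+ n * maj_prob (j + n) y.
Proof.
elim: n => [|n IH]; first by rewrite big_ord0 expr0 mul1r add0r addn0.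
rewrite IH big_ord_recr/= [maj_prob (j + n) y]maj_probS addnS exprS.
by ring.
Qed.

Lemma BK_plusE y : BK_plus eps r m y = eps + (1 - 2 * eps) * maj_prob 0 y.
Proof.
case/andP: hr => r0 r1.
rewrite /BK_plus; apply/cvg_lim => //.
rewrite -(cvg_shiftS (fun n => \sum_(1 <= k < n) _)) /=.
have -> : (fun n => \sum_(1 <= k < n.+1) (BK_lambda r k *
     BK_phi eps ((m k)%:R^-1 * \sum_(1 <= i < (m k).+1) spin (y i.-1)))) =
   (fun n => eps * (1 - r ^+ n) + (1 - 2 * eps) * series
    (fun k => (1 - r) * r ^+ k * (majority (0 + k).+1 y)%:R) n).
  apply/funext; elim => [|n IH].
    by rewrite big_nil /series /= big_nil expr0; ring.
  rewrite big_nat_recr//= IH BK_phiE// /series /= big_nat_recr//= add0n.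
  rewrite /BK_lambda exprS; set S := \sum_(0 <= _ < _) _.
  by field; rewrite gt_eqF.
apply: cvgD; last by apply: cvgMr; exact: is_cvg_maj_prob.
rewrite -[X in _ --> X]mulr1; apply: cvgMr.
rewrite -[X in _ --> X]subr0; apply: cvgB; first exact: cvg_cst.
by apply: cvg_expr; rewrite ger0_norm ?ltW.
Qed.

Lemma BK_kernel_ge a y : eps <= BK_kernel eps r m a y.
Proof.
have /andP[e0 e1] := heps; have /andP[M0 M1] := maj_prob_bounds 0 y.
by case: a; rewrite /BK_kernel BK_plusE; nra.
Qed.

Lemma BK_kernel_le1 a y : BK_kernel eps r m a y <= 1.
Proof.
have /andP[e0 e1] := heps; have /andP[M0 M1] := maj_prob_bounds 0 y.
by case: a; rewrite /BK_kernel BK_plusE; nra.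
Qed.

(** Pasts that agree on m J coordinates have the same majority in each of the
    first J windows, and the other windows have total weight r ^+ J. *)
Lemma BK_kernel_osc J a y y' : (1 <= J)%N ->
  (forall i, (i < m J)%N -> y i = y' i) ->
  BK_kernel eps r m a y <= BK_kernel eps r m a y' + r ^+ J.
Proof.
move=> J1 yy'.
have mJ k : (k < J)%N -> majority k.+1 y = majority k.+1 y'.
  move=> kJ; apply: eq_majority => i im; apply: yy'.
  apply: (leq_trans im); move: kJ; rewrite leq_eqVlt => /orP[/eqP->//|kJ].
  exact/ltnW/m_incr.
have /andP[e0 e1] := heps; have /andP[r0 r1] := hr.
have /andP[A0 A1] := maj_prob_bounds (0 + J) y.
have /andP[B0 B1] := maj_prob_bounds (0 + J) y'.
have rJ : 0 < r ^+ J by rewrite exprn_gt0.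
rewrite /BK_kernel !BK_plusE !(maj_prob_iter 0 J).
have -> : \sum_(k < J) (1 - r) * r ^+ k * (majority (0 + k).+1 y)%:R =
     \sum_(k < J) (1 - r) * r ^+ k * (majority (0 + k).+1 y')%:R.
  by apply: eq_bigr => k _; rewrite add0n mJ.
set S := \sum_(k < J) _; set A := maj_prob _ y in A0 A1 *.
set B := maj_prob _ y' in B0 B1 *.
have AB : -1 <= A - B <= 1 by apply/andP; split; lra.
have : `|(1 - 2 * eps) * (r ^+ J * (A - B))| <= r ^+ J.
  have D : `|r ^+ J * (A - B)| <= r ^+ J.
    by rewrite normrM (ger0_norm (ltW rJ)) ler_piMr ?ler_norml// ltW.
  rewrite normrM; apply: le_trans D; rewrite ler_piMl// ler_norml.
  by apply/andP; split; lra.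
by rewrite ler_norml => /andP[C D]; case: a; lra.
Qed.

End kernel.

(** * Comparison of two compatible chains *)

Section cylinders.
Context {R : realType}.

Lemma mem_bools (b : bool) : b \in [:: true; false].
Proof. by case: b. Qed.

Lemma measurable_bool_set (B : set bool) : measurable B.
Proof. by []. Qed.

Lemma measurable_config_word a n (S : set (seq bool)) :
  measurable ([set x | S (word a n x)] : set config).
Proof. exact: (measurable_word mem_bools measurable_bool_set). Qed.

Lemma measurable_past_of : measurable_fun [set: config] (past_of : config -> past).
Proof.
apply: measurable_fun_coord => i B _.
exact: (measurable_coord measurable_bool_set (- i.+1%:Z)).
Qed.

Definition cylinder (a : int) (w : seq bool) : set config :=
  [set x | word a (size w) x = w].

Lemma measurable_cylinder a w : measurable (cylinder a w).
Proof. exact: (measurable_config_word a (size w) [set w]). Qed.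

Lemma cylinder_shift a w : @shiftZ bool @^-1` (cylinder a w) = cylinder (a + 1) w.
Proof. by apply/seteqP; split => x /=; rewrite /cylinder /= word_shiftZ. Qed.

Lemma stationary_cylinder (mu : probability config R) a w :
  stationary mu -> pr mu (cylinder a w) = pr mu (cylinder 0 w).
Proof.
move=> mu_st; have st b : pr mu (cylinder (b + 1) w) = pr mu (cylinder b w).
  rewrite -cylinder_shift /pr mu_st//; exact: measurable_cylinder.
case: (intP a) => [//|n|n].
  elim: (n.+1) => [//|k IH].
  by rewrite -IH -(st k%:Z); congr (pr _ (cylinder _ _)); lia.
elim: (n.+1) => [//|k IH].
by rewrite -IH -(st (- k.+1%:Z)); congr (pr _ (cylinder _ _)); lia.
Qed.

Definition past_cylinder (w : seq bool) : set past :=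
  [set y : nat -> bool | map y (iota 0 (size w)) = rev w].

Lemma past_cylinderE (w : seq bool) (y : past) : past_cylinder w y <->
  forall k, (k < size w)%N -> y k = nth true w (size w - k.+1).
Proof.
rewrite /past_cylinder /=; split => [yw k kw|yw].
  by rewrite -nth_rev// -yw (nth_map 0%N) ?size_iota// nth_iota.
apply: (@eq_from_nth _ true); rewrite ?size_rev size_map size_iota// => k kw.
by rewrite (nth_map 0%N) ?size_iota// nth_iota// nth_rev// yw.
Qed.

Lemma measurable_past_cylinder w : measurable (past_cylinder w).
Proof.
exact: (measurable_trace mem_bools measurable_bool_set (iota 0 (size w)) [set rev w]).
Qed.

Lemma past_of_cylinder w :
  past_of @^-1` (past_cylinder w) = cylinder (- (size w)%:Z) w.
Proof.
apply/seteqP; split => x /=.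
  move/past_cylinderE => xw; apply: (@eq_from_nth _ true); rewrite size_word//.
  move=> k kw; rewrite nth_word//.
  transitivity (past_of x (size w - k.+1)%N); first by rewrite /past_of; congr x; lia.
  rewrite xw; last lia.
  by congr nth; lia.
move=> xw; apply/past_cylinderE => k kw; rewrite -[in RHS]xw.
rewrite size_word nth_word; last lia.
by rewrite /past_of; congr x; lia.
Qed.

Lemma cylinder_rcons w b : cylinder (- (size w)%:Z) (rcons w b) =
  [set x | x 0 = b] `&` past_of @^-1` (past_cylinder w).
Proof.
rewrite past_of_cylinder /cylinder size_rcons; apply/seteqP.
have e : - (size w)%:Z + (size w)%:Z = 0 by lia.
split => x /=; rewrite word_rcons e.
  by move=> /rcons_inj [-> ->].
by move=> [-> ->].
Qed.

Lemma past_word (w : seq bool) : exists y : past, past_cylinder w y.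
Proof.
by exists (fun k => nth true w (size w - k.+1)); apply/past_cylinderE.
Qed.

End cylinders.

Section comparison.
Context {R : realType}.
Variables (eps r : R) (m : nat -> nat).
Hypothesis heps : 0 < eps < 1 / 2.
Hypothesis hr : 0 < r < 1.
Hypothesis m_odd : forall j : nat, (1 <= j)%N -> odd (m j).
Hypothesis m_incr : forall i j : nat, (1 <= i)%N -> (i < j)%N -> (m i < m j)%N.

Section compatible_chain.
Variable mu : probability config R.
Hypothesis mu_st : stationary mu.
Hypothesis mu_comp : compatible (BK_kernel eps r m) mu.

Let mcyl w : measurable (past_of @^-1` past_cylinder w).
Proof. by rewrite past_of_cylinder; exact: measurable_cylinder. Qed.

Let mkernel w b : measurable_fun (past_of @^-1` past_cylinder w)
  (fun x : config => (BK_kernel eps r m b (past_of x))%:E).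
Proof.
have [mg _] := mu_comp b.
apply/measurable_EFinP; apply: measurable_funTS.
exact: (measurableT_comp mg measurable_past_of).
Qed.

Lemma cylinder_rcons_le w b (c : R) : 0 <= c ->
  (forall y, past_cylinder w y -> BK_kernel eps r m b y <= c) ->
  pr mu (cylinder 0 (rcons w b)) <= c * pr mu (cylinder 0 w).
Proof.
move=> c0 Pc; have [mg muP] := mu_comp b.
rewrite -!(stationary_cylinder (- (size w)%:Z) _ mu_st) cylinder_rcons.
rewrite -past_of_cylinder -lee_fin EFinM -!prE//; last first.
  rewrite -cylinder_rcons; exact: measurable_cylinder.
rewrite muP; last exact: measurable_past_cylinder.
rewrite -integral_cst//; apply: ge0_le_integral => //=.
- move=> x _; rewrite lee_fin.
  by apply: le_trans (BK_kernel_ge heps hr m_odd b _); case/andP: heps => /ltW.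
- by move=> x xw; rewrite lee_fin Pc.
Qed.

Lemma cylinder_rcons_ge w b (c : R) : 0 <= c ->
  (forall y, past_cylinder w y -> c <= BK_kernel eps r m b y) ->
  c * pr mu (cylinder 0 w) <= pr mu (cylinder 0 (rcons w b)).
Proof.
move=> c0 Pc; have [mg muP] := mu_comp b.
rewrite -!(stationary_cylinder (- (size w)%:Z) _ mu_st) cylinder_rcons.
rewrite -past_of_cylinder -lee_fin EFinM -!prE//; last first.
  rewrite -cylinder_rcons; exact: measurable_cylinder.
rewrite muP; last exact: measurable_past_cylinder.
rewrite -integral_cst//; apply: ge0_le_integral => //=.
by move=> x xw; rewrite lee_fin Pc.
Qed.

End compatible_chain.

Variables mu nu : probability config R.
Hypothesis mu_st : stationary mu.
Hypothesis mu_comp : compatible (BK_kernel eps r m) mu.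
Hypothesis nu_st : stationary nu.
Hypothesis nu_comp : compatible (BK_kernel eps r m) nu.


(** Conditionally on w, each chain chooses b with a probability that lies between
    the bounds of the kernel over the pasts that end with w; these bounds differ
    by at most r ^+ J and are at least eps. *)
Lemma cylinder_ratio J w b (C : R) : (1 <= J)%N -> (m J <= size w)%N -> 0 <= C ->
  pr nu (cylinder 0 w) <= C * pr mu (cylinder 0 w) ->
  pr nu (cylinder 0 (rcons w b)) <=
    C * (1 + r ^+ J / eps) * pr mu (cylinder 0 (rcons w b)).
Proof.
move=> J1 Jw C0 numu; have [y0 y0w] := past_word w.
set p := BK_kernel eps r m b y0.
have /andP[e0 e1] := heps; have /andP[r0 r1] := hr.
have rJ : 0 < r ^+ J by rewrite exprn_gt0.
have osc y y' : past_cylinder w y -> past_cylinder w y' ->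
    BK_kernel eps r m b y <= BK_kernel eps r m b y' + r ^+ J.
  move=> /past_cylinderE yw /past_cylinderE y'w; apply: BK_kernel_osc => // i iJ.
  by rewrite yw ?y'w//; apply: leq_trans Jw.
(* the least probability of b over the pasts that end with w *)
pose q := inf [set BK_kernel eps r m b y | y in past_cylinder w].
have q_lb : lbound [set BK_kernel eps r m b y | y in past_cylinder w] eps.
  by move=> _ [y _ <-]; exact: BK_kernel_ge.
have q_ne : [set BK_kernel eps r m b y | y in past_cylinder w] !=set0.
  by exists p, y0.
have eq : eps <= q by apply: lb_le_inf.
have qle y : past_cylinder w y -> q <= BK_kernel eps r m b y.
  by move=> yw; apply: ge_inf; [exists eps|exists y].
have leq y : past_cylinder w y -> BK_kernel eps r m b y <= q + r ^+ J.
  move=> yw; rewrite -lerBlDr; apply: lb_le_inf => // _ [y' y'w <-].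
  by rewrite lerBlDr osc.
have A := cylinder_rcons_le nu_st nu_comp (addr_ge0 (le_trans (ltW e0) eq) (ltW rJ)) leq.
have B := cylinder_rcons_ge mu_st mu_comp (le_trans (ltW e0) eq) qle.
apply: (le_trans A).
have q0 : 0 < q by apply: lt_le_trans eq.
have D : q + r ^+ J <= q * (1 + r ^+ J / eps).
  rewrite mulrDr mulr1 lerD2l mulrCA ler_pMr// ler_pdivlMr// mul1r//.
apply: (@le_trans _ _ (q * (1 + r ^+ J / eps) * (C * pr mu (cylinder 0 w)))).
  apply: ler_pM => //; first by rewrite addr_ge0 ?ltW.
  exact: pr_ge0.
rewrite [leLHS](_ : _ = C * (1 + r ^+ J / eps) * (q * pr mu (cylinder 0 w))).
  apply: ler_wpM2l => //; apply: mulr_ge0 => //.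
  by rewrite addr_ge0// divr_ge0 ?ltW.
by ring.
Qed.

(** The ratio of the probabilities of a word under two compatible chains grows
    subexponentially with its length: each of the first m J symbols costs at most
    the factor 1 + 1 / eps, and each later one at most 1 + kappa. *)
Lemma cylinder_comparison (kappa : R) : 0 < kappa ->
  exists D : R, forall w, pr nu (cylinder 0 w) <=
    D * (1 + kappa) ^+ size w * pr mu (cylinder 0 w).
Proof.
move=> k0; have /andP[e0 e1] := heps; have /andP[r0 r1] := hr.
have [J J1 rJk] : exists2 J, (1 <= J)%N & r ^+ J / eps <= kappa.
  have : r ^+ n.+1 @[n --> \oo] --> (0 : R).
    by rewrite (cvg_shiftS (fun n => r ^+ n)); apply: cvg_expr; rewrite ger0_norm ?ltW.
  move/cvgr0Pnorm_lt => /(_ (kappa * eps)) [|N _ /(_ N (leqnn _))].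
    by rewrite mulr_gt0.
  rewrite ger0_norm ?exprn_ge0 ?ltW// => rN; exists N.+1 => //.
  by rewrite ler_pdivrMr// ltW.
have C1 : 1 <= 1 + eps^-1 by rewrite lerDl invr_ge0 ltW.
have step w b (C : R) : 0 <= C ->
    pr nu (cylinder 0 w) <= C * pr mu (cylinder 0 w) ->
    pr nu (cylinder 0 (rcons w b)) <=
      C * (1 + eps^-1) * pr mu (cylinder 0 (rcons w b)).
  move=> C0 numu.
  have A := @cylinder_rcons_le nu nu_st nu_comp w b 1 ler01
    (fun y _ => BK_kernel_le1 heps hr m_odd b y).
  have B := @cylinder_rcons_ge mu mu_st mu_comp w b eps (ltW e0)
    (fun y _ => BK_kernel_ge heps hr m_odd b y).
  rewrite mul1r in A; apply: (le_trans A); apply: (le_trans numu).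
  rewrite -mulrA; apply: ler_wpM2l => //.
  rewrite -ler_pdivlMl// mulrC in B; apply: (le_trans B).
  by rewrite mulrC; apply: ler_wpM2r; [exact: pr_ge0|rewrite lerDr].
exists ((1 + eps^-1) ^+ m J) => w.
elim/last_ind: w => [|w b IH].
  rewrite expr0 mulr1 (_ : cylinder 0 [::] = setT); last exact/seteqP.
  by rewrite !pr_setT mulr1 exprn_ege1.
have [Jw|wJ] := leqP (m J) (size w).
  have C0 : 0 <= (1 + eps^-1) ^+ m J * (1 + kappa) ^+ size w.
    by rewrite mulr_ge0// exprn_ge0 ?addr_ge0 ?invr_ge0 ?ltW.
  apply: (le_trans (cylinder_ratio _ J1 Jw C0 IH)).
  rewrite size_rcons exprSr mulrA; apply: ler_wpM2r; first exact: pr_ge0.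
  by apply: ler_wpM2l => //; rewrite lerD2l.
have main v : pr nu (cylinder 0 v) <= (1 + eps^-1) ^+ size v * pr mu (cylinder 0 v).
  elim/last_ind: v => [|v c IHv].
    rewrite expr0 mul1r (_ : cylinder 0 [::] = setT); last exact/seteqP.
    by rewrite !pr_setT.
  rewrite size_rcons exprSr; apply: step => //.
  by rewrite exprn_ge0 ?addr_ge0 ?invr_ge0 ?ltW.
apply: (le_trans (main _)); apply: ler_wpM2r; first exact: pr_ge0.
rewrite -[leLHS]mulr1; apply: ler_pM => //; first by rewrite exprn_ge0 ?(le_trans _ C1).
  by rewrite ler_weXn2l// size_rcons.
by rewrite exprn_ege1// lerDl ltW.
Qed.

End comparison.

(** * Exponential moments of coded events *)

Fixpoint block_prod {R : realType} (T : Type) (F : seq T -> R) l M w : R :=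
  if M is M'.+1 then F (take l w) * block_prod F l M' (drop l w) else 1.

Lemma block_prod_ge0 {R : realType} (T : Type) (F : seq T -> R) l M w :
  (forall v, 0 <= F v) -> 0 <= block_prod F l M w.
Proof. by move=> F0; elim: M w => //= M IH w; rewrite mulr_ge0. Qed.

Lemma equivariant_shift_by (T T' : Type) (Phi : (int -> T) -> int -> T') :
  (forall u, Phi (shiftZ u) = shiftZ (Phi u)) ->
  forall a u, Phi (shift_by a u) = shift_by a (Phi u).
Proof.
move=> Phi_shift a u.
have Phin n v : Phi (iter n (@shiftZ T) v) = iter n (@shiftZ T') (Phi v).
  by elim: n => //= n IH; rewrite Phi_shift IH.
have [n [->|->]] : exists n : nat, a = n%:Z \/ a = - n%:Z.
  by exists `|a|%N; lia.
  by rewrite !shift_by_iter Phin.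
rewrite -[u in RHS](shift_byK n%:Z) [in RHS]shift_by_iter Phin -shift_by_iter.
by rewrite shift_byNK.
Qed.

Section finitary.
Context {R : realType}.

(** The comparison of the probabilities of words passes to nonnegative functions
    of a block. *)
Lemma integral_config_comparison (mu nu : probability config R) (D : R)
    (n : nat) (a : int) (F : seq bool -> R) :
  stationary mu -> stationary nu ->
  (forall w, 0 <= F w) ->
  (forall w, size w = n -> pr nu (cylinder 0 w) <= D * pr mu (cylinder 0 w)) ->
  (\int[nu]_x (F (word a n x))%:E <= D%:E * \int[mu]_x (F (word a n x))%:E)%E.
Proof.
move=> mu_st nu_st F0 numu.
have cylE (la : probability config R) w : size w = n -> stationary la ->
    pr la [set u | word a n u = w] = pr la (cylinder 0 w).
  move=> wn la_st; rewrite -(stationary_cylinder a w la_st).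
  by rewrite /cylinder wn.
have ub : uniq [:: true; false] by [].
rewrite !(integral_word ub mem_bools measurable_bool_set)// -EFinM lee_fin.
rewrite mulr_sumr !big_seq; apply: ler_sum => w.
rewrite mem_words; last exact: mem_bools.
move=> /eqP wn; rewrite !cylE// mulrCA; apply: ler_wpM2l => //; exact: numu.
Qed.

Section coding.
Context {d : measure_display} {U : measurableType d} (P : probability (prod_space int U) R).
Variable s : seq U.
Hypothesis s_uniq : uniq s.
Hypothesis s_all : forall t : U, t \in s.
Hypothesis mU : forall B : set U, measurable B.
Hypothesis P_iid : iid P.

Lemma integral_word_iid a n (F : seq U -> R) : (forall w, 0 <= F w) ->
  (\int[P]_u (F (word a n u))%:E =
   (\sum_(w <- words s n) F w * word_prob (letter_prob P) w)%:E)%E.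
Proof.
move=> F0; rewrite (integral_word s_uniq s_all mU)//; congr EFin.
apply: eq_big_seq => w; rewrite mem_words// => /eqP wn.
by rewrite (iid_word s_uniq s_all mU P_iid).
Qed.

(** Disjoint blocks of letters are independent. *)
Lemma integral_block_prod a l M (F : seq U -> R) : (forall w, 0 <= F w) ->
  (\int[P]_u (block_prod F l M (word a (M * l) u))%:E =
   ((\sum_(w <- words s l) F w * word_prob (letter_prob P) w) ^+ M)%:E)%E.
Proof.
move=> F0; rewrite integral_word_iid; last by move=> w; exact: block_prod_ge0.
congr EFin; elim: M => [|M IH].
  by rewrite /= big_seq1 mul1r /word_prob big_nil.
rewrite mulSn sum_words_cat exprS -IH mulr_suml; apply: eq_big_seq => w.
rewrite mem_words// => /eqP wl; rewrite mulr_sumr; apply: eq_bigr => v _.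
rewrite /= take_size_cat// drop_size_cat// /word_prob big_cat/=.
by ring.
Qed.

Variable mu : probability config R.
Variables (Phi : prod_space int U -> config) (theta1 theta2 : prod_space int U -> option nat).
Hypothesis mPhi : measurable_fun setT Phi.
Hypothesis Phi_shift : forall u, Phi (shiftZ u) = shiftZ (Phi u).
Hypothesis muE : forall B : set config, measurable B -> mu B = P (Phi @^-1` B).
Hypothesis theta1_fin : {ae P, forall u, theta1 u != None}.
Hypothesis theta2_fin : {ae P, forall u, theta2 u != None}.
Hypothesis thetaP : forall u v : prod_space int U,
  (forall i, window (theta1 u) (theta2 u) i -> u i = v i) -> Phi u 0 = Phi v 0.

Lemma negligible_shift_by (a : int) (A : set (prod_space int U)) :
  P.-negligible A -> P.-negligible (@shift_by U a @^-1` A).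
Proof.
move=> [B [mB PB AB]]; exists (@shift_by U a @^-1` B); split.
- by rewrite -[X in measurable X]setTI; exact: (measurable_shift_by mU).
- by rewrite (iid_shift_by s_uniq s_all mU P_iid).
- by move=> u; exact: AB.
Qed.

(** The coding commutes with the shifts, so that what holds almost surely at site 0
    holds almost surely at all sites at once. *)
Lemma negligible_undetermined : P.-negligible [set u | ~ forall i, exists K : nat,
  forall v, (forall j, - K%:Z <= j <= K%:Z -> u j = v j) -> Phi u i = Phi v i].
Proof.
pose Bad := [set u | theta1 u = None] `|` [set u | theta2 u = None].
have nBad : P.-negligible Bad.
  apply: negligibleU.
    by apply: negligibleS theta1_fin => u /= ->; rewrite eqxx.
  by apply: negligibleS theta2_fin => u /= ->; rewrite eqxx.
(* an enumeration of the integers *)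
pose f (n : nat) : int := if odd n then - (n./2)%:Z else (n./2)%:Z.
have fsurj i : exists n, f n = i.
  case: (intP i) => [|n|n]; first by exists 0%N.
    by exists (n.+1).*2; rewrite /f odd_double doubleK.
  by exists (n.+1).*2.+1; rewrite /f /= odd_double /= uphalf_double.
have nB := negligible_bigcup (fun n => negligible_shift_by (f n) nBad).
apply: (negligibleS _ nB) => u /= uB; apply: contrapT => uG; apply: uB => i.
have [n fn] := fsurj i.
have : ~ Bad (shift_by i u) by move=> Bu; apply: uG; exists n => //=; rewrite fn.
move=> /not_orP[].
case t1 : (theta1 (shift_by i u)) => [k|]; last by move=> /(_ t1).
case t2 : (theta2 (shift_by i u)) => [l|]; last by move=> _ /(_ t2).
move=> _ _.
exists (k + l + `|i|)%N => v uv.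
have := @thetaP (shift_by i u) (shift_by i v).
rewrite !(equivariant_shift_by Phi_shift) /shift_by add0r; apply => j.
rewrite t1 t2 /window /= => /andP[kj jl].
by apply: uv; lia.
Qed.

(** An event on finitely many symbols is almost an event on finitely many letters:
    the letters of a large window almost surely determine the symbols, so the
    sequences that the window alone does not exclude decrease to the event. *)
Lemma local_cover (n : nat) (S : set (seq bool)) (delta : R) : 0 < delta ->
  let C := [set x | S (word (- n%:Z) (n + n).+1 x)] : set config in
  exists (K : nat) (E : set (seq U)), [/\ (n <= K)%N,
    (forall u, C (Phi u) -> E (word (- K%:Z) (K + K).+1 u)) &
    pr P [set u | E (word (- K%:Z) (K + K).+1 u)] <= pr mu C + delta].
Proof.
move=> d0 C.
(* the words of the window that some sequence in the event extends *)
pose E (K : nat) : set (seq U) := [set w | exists2 v : prod_space int U,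
  word (- K%:Z) (K + K).+1 v = w & C (Phi v)].
pose F (K : nat) : set (prod_space int U) := [set u | E K (word (- K%:Z) (K + K).+1 u)].
have mF K : measurable (F K) by exact: (measurable_word s_all mU).
have mC : measurable C by exact: measurable_config_word.
have mPC : measurable (Phi @^-1` C) by rewrite -[X in measurable X]setTI; exact: mPhi.
have Fanti : {homo F : p q / (p <= q)%N >-> (q <= p)%O}.
  move=> p q pq; apply/subsetPset => u /= [v vu Cv]; exists v => //.
  apply: eq_word => i ip; apply: (word_inj vu); lia.
have mcap : measurable (\bigcap_K F K) by exact: bigcapT_measurable.
have cvF : (P \o F) K @[K --> \oo] --> P (\bigcap_K F K).
  apply: nonincreasing_cvg_mu => //.
  exact: (le_lt_trans (probability_le1 P (mF 0%N)) (ltry 1)).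
have PF : P (\bigcap_K F K) = mu C.
  rewrite muE//; have [N [mN PN badN]] := negligible_undetermined.
  apply/eqP; rewrite eq_le; apply/andP; split; last first.
    apply: le_measure; rewrite ?inE// => u Cu K _ /=.
    by exists u.
  apply: (@le_trans _ _ (P (Phi @^-1` C `|` N))); last first.
    apply: (le_trans (measureU2 P mPC mN)).
    by rewrite [X in (_ + X)%E](_ : _ = 0%E) ?adde0.
  apply: le_measure; rewrite ?inE//; first exact: measurableU.
  move=> u Fu; have [Nu|Nu] := pselect (N u); [by right|left].
  have {Nu} good : forall i, exists K : nat, forall v,
      (forall j, - K%:Z <= j <= K%:Z -> u j = v j) -> Phi u i = Phi v i.
    by apply: contrapT => bad; apply: Nu; exact: badN.
  have [K KP] := choice good.
  pose K' := (\max_(i <- interval_from (- n%:Z) (n + n).+1) K i)%N.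
  have [v vu Cv] := Fu K' I.
  rewrite /C /= (_ : word _ _ (Phi u) = word (- n%:Z) (n + n).+1 (Phi v))//.
  apply: eq_word => i ni; apply: KP => j Kj; symmetry; apply: (word_inj vu).
  have : (K i <= K')%N by apply: leq_bigmax_seq; rewrite ?mem_interval_from.
  lia.
move: cvF; rewrite PF (prE mu mC) => /fine_cvgP[_].
move/cvgrPdist_lt => /(_ _ d0)[N _ NP].
exists (maxn n N), (E (maxn n N)); split; first exact: leq_maxl.
  by move=> u Cu; exists u.
have := NP (maxn n N) (leq_maxr _ _) => /=.
rewrite -/(pr P _) -/(F _) ltr_norml => /andP[A B].
have {}A : - delta < pr mu C - pr P (F (maxn n N)) by exact: A.
by rewrite /F /= in A *; lra.
Qed.

Lemma integral_coding a n (F : seq bool -> R) : (forall w, 0 <= F w) ->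
  (\int[mu]_x (F (word a n x))%:E = \int[P]_u (F (word a n (Phi u)))%:E)%E.
Proof.
move=> F0.
have ub : uniq [:: true; false] by [].
rewrite (integral_word ub mem_bools measurable_bool_set)//.
have mw w : measurable [set u : prod_space int U | word a n (Phi u) = w].
  have := measurable_config_word a n [set w].
  by move=> /(mPhi measurableT); rewrite setTI.
rewrite (integral_finite_valued P (l := words [:: true; false] n)
  (X := fun u => word a n (Phi u)))//.
- congr EFin; apply: eq_bigr => w _; congr (_ * fine _); apply: muE.
  exact: (measurable_config_word a n [set w]).
- exact: words_uniq.
- by move=> u; rewrite mem_words ?size_word//; exact: mem_bools.
Qed.

End coding.
End finitary.

Lemma block_prod_word {R : realType} {U : Type} (F : seq U -> R) l M a u :
  block_prod F l M.+1 (word a (M.+1 * l) u) =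
  F (word a l u) * block_prod F l M (word (a + l%:Z) (M * l) u).
Proof. by rewrite mulSn /= drop_word take_word ?leq_addr. Qed.

Lemma block_prod_mono {R : realType} {T U : Type} (F : seq T -> R) (G : seq U -> R)
    l M a (x : int -> T) (u : int -> U) :
  (forall w, 0 <= F w) -> (forall w, 0 <= G w) ->
  (forall b, F (word b l x) <= G (word b l u)) ->
  block_prod F l M (word a (M * l) x) <= block_prod G l M (word a (M * l) u).
Proof.
move=> F0 G0 FG; elim: M a => [//|M IH] a.
by rewrite !block_prod_word; apply: ler_pM => //; exact: block_prod_ge0.
Qed.

Lemma expR_le_inv {R : realType} (x : R) : x < 1 -> expR x <= (1 - x)^-1.
Proof.
move=> x1; have := expR_ge1Dx (- x); rewrite expRN => h.
by rewrite -[leLHS]invrK lef_pV2 ?posrE ?invr_gt0 ?expR_gt0 ?subr_gt0.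
Qed.

Section exponential_moment.
Context {R : realType}.

(** For small t, the factor 1 + q (exp t - 1) is below 1 + t p <= exp (t p). The
    bound exp t <= 1 / (1 - t) makes t = (p - q) / 2 small enough. *)
Lemma bernoulli_exp_moment (p q t : R) : 0 <= q -> q < p -> p <= 1 ->
  t = (p - q) / 2 ->
  q * expR (t * (1 - p)) + (1 - q) * expR (t * (0 - p)) < 1.
Proof.
move=> q0 qp p1 tE.
have t0 : 0 < t by rewrite tE divr_gt0 ?subr_gt0.
have t1 : t < 1 by rewrite tE; lra.
rewrite (_ : t * (1 - p) = t + - (t * p)); last by ring.
rewrite (_ : t * (0 - p) = - (t * p)); last by ring.
rewrite expRD mulrA -mulrDl expRN ltr_pdivrMr ?expR_gt0// mul1r.
apply: (@lt_le_trans _ _ (1 + t * p)); last exact: expR_ge1Dx.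
have et := expR_le_inv t1.
have t10 : 0 < 1 - t by lra.
apply: (@le_lt_trans _ _ (q * (1 - t)^-1 + (1 - q))).
  by rewrite lerD2r ler_wpM2l.
rewrite -(ltr_pM2r t10) mulrDl mulfVK ?gt_eqF//.
have tp : t * p <= t by apply: ler_piMr => //; exact: ltW.
have : 0 < t * (p - t * p - q) by rewrite mulr_gt0//; lra.
lra.
Qed.

(** Geometric decay absorbs a growth at a sufficiently small exponential rate. *)
Lemma geometric_slack (rho : R) (l : nat) : 0 <= rho -> rho < 1 ->
  exists2 k : R, 0 < k & (1 + k) ^+ l * rho < 1.
Proof.
move=> rho0 rho1; pose t := (1 - rho) / 2.
have t0 : 0 < t by rewrite divr_gt0 ?subr_gt0.
have t1 : t < 1 by rewrite /t; lra.
exists (t / l.+1%:R); first by rewrite divr_gt0.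
apply: (@le_lt_trans _ _ (expR t * rho)).
  apply: ler_wpM2r => //.
  apply: (@le_trans _ _ (expR (t / l.+1%:R) ^+ l)).
    have x0 : 0 <= t / l.+1%:R by rewrite divr_ge0// ltW.
    apply: lerXn2r; last exact: expR_ge1Dx.
      by rewrite nnegrE addr_ge0.
    by rewrite nnegrE expR_ge0.
  have l1 : l%:R / l.+1%:R <= 1 :> R by rewrite ler_pdivrMr// mul1r ler_nat.
  by rewrite -expRM_natl ler_expR mulrCA; apply: ler_piMr => //; exact: ltW.
have t10 : 0 < 1 - t by lra.
apply: (@le_lt_trans _ _ ((1 - t)^-1 * rho)).
  by apply: ler_wpM2r => //; exact: expR_le_inv.
by rewrite mulrC ltr_pdivrMr// mul1r /t; lra.
Qed.

End exponential_moment.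

Fixpoint block_count (T : Type) (S : set (seq T)) l M (w : seq T) : nat :=
  if M is M'.+1 then `[< S (take l w) >] + block_count S l M' (drop l w) else 0.

Lemma block_prod_expR {R : realType} (T : Type) (S : set (seq T)) l M w (t p : R) :
  block_prod (fun v => expR (t * ((`[< S v >])%:R - p))) l M w =
  expR (t * ((block_count S l M w)%:R - M%:R * p)).
Proof.
elim: M w => [|M IH] w; first by rewrite /= mul0r subr0 mulr0 expR0.
by rewrite /= IH -expRD natrD -[M.+1%:R]natr1; congr expR; ring.
Qed.

Section exponential_lower_bound.
Context {R : realType} (nu : probability config R).
Hypothesis nu_st : stationary nu.

Lemma stationary_word a n (S : set (seq bool)) :
  pr nu [set x | S (word a n x)] = pr nu [set x | S (word 0 n x)].
Proof.
have ub : uniq [:: true; false] by [].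
rewrite !(pr_word ub mem_bools measurable_bool_set).
apply: eq_big_seq => w; rewrite mem_words; last exact: mem_bools.
move=> /eqP <-; congr (_ * _).
exact: (stationary_cylinder a w nu_st).
Qed.

Lemma integral_block_count (S : set (seq bool)) l M a :
  (\int[nu]_x ((block_count S l M (word a (M * l) x))%:R : R)%:E =
   (M%:R * pr nu [set x | S (word 0 l x)])%:E)%E.
Proof.
elim: M a => [|M IH] a.
  by rewrite (eq_integral (cst 0%E))// integral0 mul0r.
have E x : ((block_count S l M.+1 (word a (M.+1 * l) x))%:R : R)%:E =
   (((`[< S (word a l x) >])%:R : R)%:E +
    ((block_count S l M (word (a + l%:Z) (M * l) x))%:R : R)%:E)%E.
  by rewrite mulSn /= drop_word take_word ?leq_addr// natrD EFinD.
under eq_integral do rewrite E.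
have ub : uniq [:: true; false] by [].
have mF (F : seq bool -> R) b k : measurable_fun [set: config] (fun x => (F (word b k x))%:E).
  by apply/measurable_EFinP; exact: (measurable_fun_word mem_bools measurable_bool_set).
rewrite ge0_integralD//=; last 2 first.
- exact: (mF (fun w => (`[< S w >])%:R)).
- exact: (mF (fun w => (block_count S l M w)%:R)).
rewrite IH (integral_word ub mem_bools measurable_bool_set nu a l (F := fun w => (`[< S w >])%:R))//.
rewrite -(pr_word ub mem_bools measurable_bool_set) stationary_word -EFinD.
by congr EFin; rewrite -natr1; ring.
Qed.

(** Jensen's inequality for the number of occurrences in M blocks, in the form
    1 + x <= exp x: the exponent has mean 0. *)
Lemma exponential_moment_ge1 (S : set (seq bool)) l M a (t p : R) :
  0 <= t -> p = pr nu [set x | S (word 0 l x)] ->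
  (1%:E <= \int[nu]_x (block_prod (fun v => expR (t * ((`[< S v >])%:R - p)))
                       l M (word a (M * l) x))%:E)%E.
Proof.
move=> t0 pE.
have p0 : 0 <= p by rewrite pE pr_ge0.
have mF (F : seq bool -> R) b k : measurable_fun [set: config] (fun x => (F (word b k x))%:E).
  by apply/measurable_EFinP; exact: (measurable_fun_word mem_bools measurable_bool_set).
have tMp : (0 <= (t * (M%:R * p))%:E)%E by rewrite lee_fin !mulr_ge0.
have key : (\int[nu]_x ((1 + t * (block_count S l M (word a (M * l) x))%:R)%:E) <=
   \int[nu]_x ((block_prod (fun v => expR (t * ((`[< S v >])%:R - p)))
                       l M (word a (M * l) x))%:E + (t * (M%:R * p))%:E))%E.
  apply: ge0_le_integral => //.
  - by move=> x _; rewrite lee_fin addr_ge0 ?mulr_ge0.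
  - exact: (mF (fun w => 1 + t * (block_count S l M w)%:R)).
  - by apply: emeasurable_funD => //; exact: (mF (block_prod _ l M)).
  - move=> x _; rewrite block_prod_expR -EFinD lee_fin -lerBlDr.
    by apply: le_trans (expR_ge1Dx _); rewrite mulrBr; lra.
rewrite ge0_integralD//= in key; last first.
  by move=> x _; rewrite lee_fin block_prod_ge0// => v; exact: expR_ge0.
move: key; under eq_integral do rewrite EFinD EFinM.
rewrite ge0_integralD//=; last 2 first.
- by move=> x _; rewrite mule_ge0 ?lee_fin.
- exact: (mF (fun w => t * (block_count S l M w)%:R)).
rewrite ge0_integralZl_EFin//; last exact: (mF (fun w => (block_count S l M w)%:R)).
have intc (c : R) : (\int[nu]__ c%:E = c%:E)%E.
  rewrite (integral_cst nu measurableT) [X in (_ * X)%E](_ : _ = 1%E) ?mule1//.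
  exact: probability_setT.
rewrite integral_block_count !intc -EFinM -pE; set I := integral _ _ _.
by rewrite leeD2rE.
Qed.

End exponential_lower_bound.

Lemma word_center (T : Type) n K b (x : int -> T) : (n <= K)%N ->
  take (n + n).+1 (drop (K - n) (word b (K + K).+1 x)) =
  word (- n%:Z) (n + n).+1 (shift_by (b + K%:Z) x).
Proof.
move=> nK; rewrite word_shift_by.
have -> : (K + K).+1 = (K - n + ((n + n).+1 + (K - n)))%N by lia.
rewrite drop_word take_word ?leq_addr//.
by congr word; lia.
Qed.

Section uniqueness_from_coding.
Context {R : realType}.
Variables (eps r : R) (m : nat -> nat).
Hypothesis heps : 0 < eps < 1 / 2.
Hypothesis hr : 0 < r < 1.
Hypothesis m_odd : forall j : nat, (1 <= j)%N -> odd (m j).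
Hypothesis m_incr : forall i j : nat, (1 <= i)%N -> (i < j)%N -> (m i < m j)%N.
Variables mu nu : probability config R.
Hypothesis mu_st : stationary mu.
Hypothesis mu_comp : compatible (BK_kernel eps r m) mu.
Hypothesis nu_st : stationary nu.
Hypothesis nu_comp : compatible (BK_kernel eps r m) nu.
Hypothesis mu_coding : finitary_coding_of_finite_iid mu.

(** Suppose that nu gives the event more weight than mu. Under nu, the number of
    occurrences in M disjoint blocks, compensated by its mean, has an exponential
    moment of at least 1. Under mu, the occurrences are covered by independent
    events of smaller probability, so the moment decays geometrically in M. The
    subexponential comparison of nu with mu allows no such discrepancy. *)
Lemma local_event_le (n : nat) (S : set (seq bool)) :
  pr nu [set x | S (word (- n%:Z) (n + n).+1 x)] <=
  pr mu [set x | S (word (- n%:Z) (n + n).+1 x)].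
Proof.
have [d [U [P [finU mU P_iid [Phi [th1 [th2 [mPhi Phi_sh muE [th1f th2f] [_ thP]]]]]]]]] := mu_coding.
have /finite_seqP[s0 s0E] := finU; pose s := undup s0.
have s_uniq : uniq s by exact: undup_uniq.
have s_all x : x \in s by rewrite mem_undup; have : [set: U] x by []; rewrite s0E.
rewrite leNgt; apply/negP => mu_nu.
pose C : set config := [set x : config | S (word (- n%:Z) (n + n).+1 x)].
pose p := pr nu C.
have {}mu_nu : pr mu C < p by exact: mu_nu.
have d0 : 0 < (p - pr mu C) / 2 by rewrite divr_gt0 ?subr_gt0.
have [K [E [nK CE PE]]] := local_cover s_uniq s_all mU P_iid mPhi Phi_sh muE th1f th2f thP n S d0.
pose q := pr P [set u | E (word (- K%:Z) (K + K).+1 u)].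
have {}PE : q <= pr mu C + (p - pr mu C) / 2 by exact: PE.
have qp : q < p by lra.
have mC : measurable C by exact: measurable_config_word.
have p1 : p <= 1 by rewrite -lee_fin -prE// probability_le1.
have q0 : 0 <= q by exact: pr_ge0.
pose t := (p - q) / 2.
have t0 : 0 < t by rewrite divr_gt0 ?subr_gt0.
(* With this block length the covering events of different blocks depend on
   different letters. *)
pose l := (K + K).+1.
pose S' : set (seq bool) := [set w | S (take (n + n).+1 (drop (K - n) w))].
have S'P b x : S' (word b l x) <-> C (shift_by (b + K%:Z) x).
  by rewrite /S' /C /= word_center.
have pE : p = pr nu [set x | S' (word 0 l x)].
  have -> : [set x | S' (word 0 l x)] =
      [set x | S (word (- n%:Z + (0 + K%:Z)) (n + n).+1 x)].
    apply/seteqP; split => x /=; first by move=> /S'P; rewrite /C /= word_shift_by.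
    by move=> Sx; apply/S'P; rewrite /C /= word_shift_by.
  by rewrite /p /C (stationary_word nu_st (- n%:Z)) [RHS](stationary_word nu_st).
pose f (T : Type) (B : set (seq T)) (w : seq T) : R := expR (t * ((`[< B w >])%:R - p)).
have f0 (T : Type) (B : set (seq T)) w : 0 <= f T B w by exact: expR_ge0.
pose rho := \sum_(w <- words s l) f U E w * word_prob (letter_prob P) w.
have rho0 : 0 <= rho.
  apply: sumr_ge0 => w _; rewrite mulr_ge0// /word_prob.
  by apply: prodr_ge0 => x _; exact: pr_ge0.
have rho1 : rho < 1.
  apply: (le_lt_trans _ (bernoulli_exp_moment q0 qp p1 erefl)); rewrite -/t.
  have qE : q = \sum_(w <- words s l) (`[< E w >])%:R * word_prob (letter_prob P) w.
    rewrite /q (pr_word s_uniq s_all mU); apply: eq_big_seq => w.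
    by rewrite mem_words// => /eqP wl; rewrite (iid_word s_uniq s_all mU P_iid).
  have sum1 : \sum_(w <- words s l) word_prob (letter_prob P) w = 1.
    rewrite -(pr_setT P); have := pr_word s_uniq s_all mU P (- K%:Z) l setT.
    rewrite (_ : [set u | _] = setT)// => ->; apply: eq_big_seq => w.
    rewrite mem_words// => /eqP wl; rewrite (iid_word s_uniq s_all mU P_iid)//.
    by rewrite asboolT// mul1r.
  set e1 := expR (t * (1 - p)); set e0 := expR (t * (0 - p)).
  suff -> : rho = q * e1 + (1 - q) * e0 by [].
  rewrite -[1 in RHS]sum1 qE mulrBl !mulr_suml -sumrB -big_split.
  apply: eq_bigr => w _; rewrite /f /=.
  by case: asboolP => _ /=; rewrite ?mulr1n ?mulr0n -?/e1 -?/e0; ring.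
have [k k0 krho] := geometric_slack l rho0 rho1.
have [D numu] := cylinder_comparison heps hr m_odd m_incr mu_st mu_comp nu_st nu_comp k0.
have main M : 1 <= D * ((1 + k) ^+ l * rho) ^+ M.
  rewrite -lee_fin.
  apply: (le_trans (exponential_moment_ge1 nu_st M (- K%:Z) (ltW t0) pE)).
  apply: (le_trans (integral_config_comparison (D := D * (1 + k) ^+ (M * l)) _ mu_st nu_st _ _)).
  - by move=> w; apply: block_prod_ge0 => v; exact: expR_ge0.
  - by move=> w <-; exact: numu.
  have D0 : 0 <= D * (1 + k) ^+ (M * l).
    have := numu (nseq (M * l) true).
    rewrite size_nseq; set y := _ * _ => ny; rewrite leNgt; apply/negP => y0.
    have := numu [::]; rewrite (_ : cylinder 0 [::] = setT); last exact/seteqP.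
    rewrite !pr_setT mulr1 expr0 mulr1 => D1.
    by move: y0; rewrite /y ltNge mulr_ge0 ?exprn_ge0 ?addr_ge0 ?ltW// (lt_le_trans _ D1).
  rewrite (integral_coding mPhi muE); last first.
    by move=> w; apply: block_prod_ge0 => v; exact: expR_ge0.
  have step : (\int[P]_u (block_prod (f bool S') l M (word (- K%:Z) (M * l) (Phi u)))%:E
      <= (rho ^+ M)%:E)%E.
    rewrite -(integral_block_prod s_uniq s_all mU P_iid (- K%:Z) l M (f0 U E)).
    apply: ge0_le_integral => //.
    - by move=> u _; rewrite lee_fin block_prod_ge0.
    - apply/measurable_EFinP.
      have mPw := measurable_fun_word mem_bools measurable_bool_set (block_prod (f bool S') l M) (- K%:Z) (M * l).
      exact: (measurableT_comp mPw mPhi).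
    - apply/measurable_EFinP; exact: (measurable_fun_word s_all mU).
    - move=> u _; rewrite lee_fin; apply: block_prod_mono => // b.
      rewrite /f ler_expR ler_pM2l// lerD2r ler_nat.
      case: asboolP => // /S'P; rewrite -(equivariant_shift_by Phi_sh) => /CE.
      rewrite word_shift_by addrCA addNr addr0.
      by move=> Eu; rewrite asboolT.
  apply: (@le_trans _ _ ((D * (1 + k) ^+ (M * l))%:E * (rho ^+ M)%:E)%E).
    by apply: lee_wpmul2l => //; rewrite lee_fin.
  by rewrite -EFinM lee_fin exprMn -exprM mulnC mulrA.
have : D * ((1 + k) ^+ l * rho) ^+ M @[M --> \oo] --> D * 0.
  apply: cvgMr; apply: cvg_expr; rewrite ger0_norm// mulr_ge0// exprn_ge0//.
  by rewrite addr_ge0// ltW.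
rewrite mulr0 => /cvgr0Pnorm_lt /(_ 1 ltr01) [N _ /(_ N (leqnn _))].
by rewrite ltNge (le_trans (main N))// ler_norm.
Qed.

(** The inequality for an event and for its complement is an equality. *)
Lemma unique_from_coding (B : set config) : measurable B -> nu B = mu B.
Proof.
have ub : uniq [:: true; false] by [].
move: B; apply: (measure_word_ext ub mem_bools measurable_bool_set).
  exact: (le_lt_trans (probability_le1 nu measurableT) (ltry 1)).
move=> a n S.
have [k [S' SS']] : exists k : nat, exists S' : set (seq bool),
    [set u | S (word a n u)] = [set u : config | S' (word (- k%:Z) (k + k).+1 u)].
  exists (`|a| + n)%N.
  set k := (`|a| + n)%N.
  exists [set w | S (take n (drop (absz (a + k%:Z)) w))].
  have kE : ((k + k).+1 = absz (a + k%:Z)%R + (n + ((k + k).+1 - absz (a + k%:Z)%R - n)))%N.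
    by rewrite /k; lia.
  apply/seteqP; split => u /=; rewrite kE drop_word take_word ?leq_addr//;
    by rewrite (_ : - k%:Z + Posz (absz (a + k%:Z)) = a)//; rewrite /k; lia.
have mS (Q : set (seq bool)) : measurable ([set u | Q (word (- k%:Z) (k + k).+1 u)] : set config).
  exact: measurable_config_word.
rewrite SS'; apply: (@pr_eq _ _ _ _ _ nu mu) => //.
apply/eqP; rewrite eq_le local_event_le/=.
have := local_event_le k (~` S').
rewrite (_ : [set x | (~` S') _] = ~` [set x | S' (word (- k%:Z) (k + k).+1 x)]); last by [].
rewrite !pr_setC//; lra.
Qed.

End uniqueness_from_coding.

(** * Existence of independent sequences *)

Section iid_existence.
Context {R : realType} {d : measure_display} {T : measurableType d} (s : seq T).
Hypothesis s_uniq : uniq s.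
Hypothesis s_all : forall t : T, t \in s.
Hypothesis mT : forall B : set T, measurable B.
Variable p : T -> R.
Hypothesis p_ge0 : forall x, 0 <= p x.
Hypothesis p_sum : \sum_(x <- s) p x = 1.

Definition cumul (x : T) : R := \sum_(y <- take (index x s) s) p y.

(** The interval [0, 1[ is cut into consecutive slots, one of length p x for each
    letter x; the digits of a point are the slots visited by the expanding map
    rescale, which sends each slot onto [0, 1[. *)
Definition in_slot (x : T) (om : R) : bool := cumul x <= om < cumul x + p x.

Lemma cumul_next x : cumul x + p x = \sum_(y <- take (index x s).+1 s) p y.
Proof.
by rewrite (take_nth x) ?index_mem// nth_index// -cats1 big_cat/= big_seq1.
Qed.

Lemma sum_take_mono i j : (i <= j)%N ->
  \sum_(y <- take i s) p y <= \sum_(y <- take j s) p y.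
Proof.
move=> ij; rewrite -(subnKC ij) takeD big_cat/= lerDl.
by apply: sumr_ge0.
Qed.

Lemma cumul_ge0 x : 0 <= cumul x.
Proof. by apply: sumr_ge0. Qed.

Lemma cumul_next_le1 x : cumul x + p x <= 1.
Proof.
have := @sum_take_mono (index x s).+1 (size s).
by rewrite take_size p_sum cumul_next; apply; rewrite index_mem.
Qed.

Lemma in_slot_inj x y om : in_slot x om -> in_slot y om -> x = y.
Proof.
wlog xy : x y / (index x s <= index y s)%N.
  by move=> H; case: (leqP (index x s) (index y s)) => [|/ltnW] xy xo yo;
    [exact: H|rewrite (H _ _ xy)].
move: xy; rewrite leq_eqVlt => /orP[/eqP e _ _|xy].
  by rewrite -(nth_index x (s_all x)) e nth_index.
move=> /andP[_ xo] /andP[yo _].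
have := sum_take_mono xy; rewrite -cumul_next -/(cumul y) => h.
by have := lt_le_trans xo (le_trans h yo); rewrite ltxx.
Qed.

Lemma in_slot_exists om : 0 <= om < 1 -> exists x, in_slot x om.
Proof.
move=> /andP[om0 om1].
have ex : exists i, om < \sum_(y <- take i s) p y.
  by exists (size s); rewrite take_size p_sum.
case: (ex_minnP ex) => i oi imin.
case: i oi imin => [|i] oi imin; first by move: oi; rewrite take0 big_nil ltNge om0.
have si : (i < size s)%N.
  rewrite ltnNge; apply/negP => si.
  have := imin i; rewrite take_oversize// p_sum om1 => /(_ isT); lia.
exists (nth point s i); rewrite /in_slot cumul_next /cumul index_uniq// oi andbT.
by rewrite leNgt; apply/negP => /imin; lia.
Qed.

Definition digit (om : R) : T := xget point [set x | in_slot x om].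

Definition rescale (om : R) : R := (om - cumul (digit om)) / p (digit om).

Lemma digitP om : 0 <= om < 1 -> in_slot (digit om) om.
Proof.
by move=> /in_slot_exists[x xo]; rewrite /digit; case: xgetP => [y _ //|/(_ x)].
Qed.

Lemma rescale_bounds om : 0 <= om < 1 -> 0 <= rescale om < 1.
Proof.
move=> /digitP; rewrite /in_slot /rescale => /andP[co oc].
have p0 : 0 < p (digit om) by lra.
by rewrite divr_ge0 ?subr_ge0//= ltr_pdivrMr// mul1r; lra.
Qed.

Fixpoint digits n (om : R) : seq T :=
  if n is n'.+1 then digit om :: digits n' (rescale om) else [::].

Lemma size_digits n om : size (digits n om) = n.
Proof. by elim: n om => //= n IH om; rewrite IH. Qed.

Lemma nth_digits n k om : (k < n)%N ->
  nth point (digits n om) k = digit (iter k rescale om).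
Proof.
elim: n k om => [//|n IH] [//|k] om kn /=.
by rewrite IH// -iterSr.
Qed.

Fixpoint left_end (w : seq T) : R :=
  if w is x :: w' then cumul x + p x * left_end w' else 0.

Lemma word_prob_ge0 w : 0 <= word_prob p w.
Proof. by apply: prodr_ge0. Qed.

Lemma left_end_bounds w :
  0 <= left_end w /\ left_end w + word_prob p w <= 1.
Proof.
elim: w => [|x w [IH0 IH1]] /=.
  by rewrite /word_prob big_nil; split; rewrite ?add0r.
rewrite /word_prob big_cons -/(word_prob p w).
have := cumul_ge0 x; have := cumul_next_le1 x; have := p_ge0 x.
by have := word_prob_ge0 w; split; nra.
Qed.

(** The affine map that sends [0, 1[ onto the slot of x sends the interval of w
    onto that of x :: w. *)
Lemma digits_interval w om : 0 <= om < 1 ->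
  (digits (size w) om == w) = (left_end w <= om < left_end w + word_prob p w).
Proof.
elim: w om => [|x w IH] om om01.
  by rewrite /= /word_prob big_nil eqxx add0r om01.
rewrite /= eqseq_cons IH; last exact: rescale_bounds.
rewrite /word_prob big_cons -/(word_prob p w).
have [L0 L1] := left_end_bounds w; have W0 := word_prob_ge0 w.
have px := p_ge0 x.
have [<-|dx] := eqVneq (digit om) x.
  have /andP[co oc] := digitP om01.
  have p0 : 0 < p (digit om) by lra.
  rewrite /= /rescale ler_pdivlMr// ltr_pdivrMr//.
  by congr andb; apply/idP/idP; lra.
apply/esym/negbTE/negP => /andP[A B].
move/negP: dx; apply; apply/eqP; apply: in_slot_inj (digitP om01) _.
by apply/andP; split; nra.
Qed.

Definition unit_law : probability _ R := uniform_prob (@ltr01 R).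

Lemma unit_law_itv (a b : R) : 0 <= a -> a <= b -> b <= 1 ->
  unit_law `[a, b[%classic = (b - a)%:E.
Proof.
move=> a0 ab b1; rewrite /unit_law /= /uniform_prob.
rewrite (eq_integral (cst 1%E)); last first.
  move=> x; rewrite inE/= in_itv/= => /andP[ax xb].
  by rewrite /uniform_pdf (le_trans a0 ax) (ltW (lt_le_trans xb b1)) subr0 invr1.
rewrite integral_cst//= mul1e lebesgue_measure_itv/= lte_fin.
move: ab; rewrite le_eqVlt => /orP[/eqP->|ab]; first by rewrite ltxx subrr.
by rewrite ab EFinB.
Qed.

(** Points outside [0, 1[, which form a null set for the uniform law, have no
    expansion; they share that of 0. *)
Definition clamp (om : R) : R := if (0 <= om < 1) then om else 0.

Definition digit_set (w : seq T) : set R := `[left_end w, left_end w + word_prob p w[%classic.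

Lemma measurable_digits n (S : set (seq T)) :
  measurable [set om : R | S (digits n (clamp om))].
Proof.
have -> : [set om : R | S (digits n (clamp om))] =
   ((\bigcup_(w in [set` words s n] `&` S) digit_set w) `&` `[0, 1[%classic) `|`
   (if `[< S (digits n 0) >] then ~` `[0, 1[%classic else set0).
  apply/seteqP; split => [om So|om [[[w [wn Sw] omw] om01]|]] /=.
  - have [om01|om01] := boolP (0 <= om < 1).
      left; split; last by rewrite /= in_itv.
      exists (digits n om); first split.
      + by rewrite /= mem_words// size_digits.
      + by move: So; rewrite /= /clamp om01.
      rewrite /digit_set /= in_itv/= -digits_interval// size_digits//.
    right; move: So; rewrite /= /clamp (negbTE om01) => S0.
    by rewrite asboolT//= in_itv/=; exact/negP.
  - move: om01 omw; rewrite /digit_set /= !in_itv/= => om01.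
    rewrite -digits_interval// /clamp om01.
    by move: wn; rewrite /= mem_words// => /eqP -> /eqP ->.
  case: asboolP => //= S0; rewrite in_itv/= => /negP/negbTE om01.
  by rewrite /clamp om01.
apply: measurableU.
  apply: measurableI; last exact: measurable_itv.
  apply: fin_bigcup_measurable; first exact: finite_setIl.
  by move=> w _; exact: measurable_itv.
by case: asboolP => // _; apply: measurableC; exact: measurable_itv.
Qed.

Lemma unit_law_digits w :
  pr unit_law [set om | digits (size w) (clamp om) = w] = word_prob p w.
Proof.
have [L0 L1] := left_end_bounds w; have W0 := word_prob_ge0 w.
have mD := measurable_digits (size w) [set w].
apply: EFin_inj; rewrite -prE//.
have -> : (word_prob p w)%:E = unit_law (digit_set w).
  by rewrite unit_law_itv ?lerDl// addrC addKr.
have U1 : unit_law (~` `[0, 1[%classic) = 0%E.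
  rewrite probability_setC; last exact: measurable_itv.
  by rewrite unit_law_itv// subr0 subee.
have mI : measurable (digit_set w) by exact: measurable_itv.
have mU := @measurable_itv R `[0, 1[.
apply/eqP; rewrite eq_le; apply/andP; split.
  apply: (@le_trans _ _ (unit_law (digit_set w `|` ~` `[0, 1[%classic))).
    apply: le_measure; rewrite ?inE//.
      by apply: measurableU => //; exact: measurableC.
    move=> om /= dw; have [om01|om01] := boolP (0 <= om < 1); last first.
      by right; rewrite /= in_itv/=; exact/negP.
    left; rewrite /digit_set /= in_itv/= -digits_interval//.
    by move: dw; rewrite /clamp om01 => ->.
  apply: (le_trans (measureU2 unit_law mI (measurableC mU))).
  by rewrite [X in (_ + X)%E](_ : _ = 0%E) ?adde0.
apply: le_measure; rewrite ?inE// => om; rewrite /digit_set /= in_itv/= => omw.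
have om01 : 0 <= om < 1 by lra.
by rewrite /clamp om01; apply/eqP; rewrite digits_interval.
Qed.

(** Digits indexed by nat are distributed over the sites by an injection of the
    integers into nat. *)
Definition expansion (om : R) : int -> T :=
  fun i => digit (iter (pickle i) rescale (clamp om)).

Lemma measurable_digit k (B : set T) :
  measurable [set om : R | B (digit (iter k rescale (clamp om)))].
Proof.
have := measurable_digits k.+1 [set w | B (nth point w k)].
rewrite (_ : [set om : R | _] = [set om : R | B (digit (iter k rescale (clamp om)))])//.
by apply/seteqP; split => om /=; rewrite -/(digits k.+1 _) nth_digits.
Qed.

Lemma measurable_expansion :
  measurable_fun setT (expansion : _ -> prod_space int T).
Proof.
apply: measurable_fun_coord => i B _; exact: measurable_digit.
Qed.

Definition set_prob (B : set T) : R := \sum_(x <- s) (`[< B x >])%:R * p x.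

Lemma sum_word_prob n (B : nat -> set T) :
  \sum_(w <- words s n)
     (`[< forall k, (k < n)%N -> B k (nth point w k) >])%:R * word_prob p w =
  \prod_(k < n) set_prob (B k).
Proof.
elim: n B => [|n IH] B.
  by rewrite /= big_seq1 big_ord0 /word_prob big_nil asboolT// mulr1.
rewrite sum_wordsS big_ord_recl -(IH (fun k => B k.+1)) /set_prob mulr_suml.
apply: eq_bigr => x _; rewrite mulr_sumr; apply: eq_bigr => w _.
rewrite /word_prob big_cons mulrACA; congr (_ * _).
rewrite -natrM mulnb; congr (_%:R); congr nat_of_bool.
apply/asboolP/andP => [Bw|[/asboolP B0 /asboolP Bw] [|k] kn //]; last first.
  exact: Bw.
split; apply/asboolP; first exact: (Bw 0%N).
by move=> k kn; exact: (Bw k.+1).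
Qed.

Lemma unit_law_independent n (B : nat -> set T) :
  pr unit_law [set om | forall k, (k < n)%N -> B k (digit (iter k rescale (clamp om)))] =
  \prod_(k < n) set_prob (B k).
Proof.
rewrite -sum_word_prob.
pose S := [set w | forall k, (k < n)%N -> B k (nth point w k)].
rewrite (_ : [set om | _] = [set om | S (digits n (clamp om))]); last first.
  apply/seteqP; split => om /= Bom k kn; have := Bom k kn; rewrite nth_digits//.
rewrite (pr_finite_valued (l := words s n) unit_law (X := digits n \o clamp)).
- apply: eq_big_seq => w; rewrite mem_words// => /eqP wn.
  by congr (_ * _); rewrite -unit_law_digits wn.
- exact: words_uniq.
- by move=> om; rewrite mem_words// size_digits.
- by move=> w; exact: (measurable_digits n [set w]).
Qed.

Lemma set_probT : set_prob setT = 1.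
Proof. by rewrite -p_sum; apply: eq_bigr => x _; rewrite asboolT// mul1r. Qed.

Lemma unit_law_digit k (B : set T) :
  pr unit_law [set om | B (digit (iter k rescale (clamp om)))] = set_prob B.
Proof.
pose B' j := if j == k then B else setT.
rewrite (_ : [set om | _] =
  [set om | forall j, (j < k.+1)%N -> B' j (digit (iter j rescale (clamp om)))]).
  rewrite unit_law_independent (bigD1 (@ord_max k))//= /B' eqxx big1 ?mulr1//.
  by move=> i ik; rewrite ifN ?set_probT.
apply/seteqP; split => om /=.
  by move=> Bo j _; rewrite /B'; case: eqP => [->|].
by move=> /(_ k (ltnSn k)); rewrite /B' eqxx.
Qed.

(** The digits of a uniform point of [0, 1[ are independent, since the words cut
    [0, 1[ into intervals of product lengths. *)
Lemma iid_exists : exists P : probability (prod_space int T) R,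
  iid P /\ forall x, letter_prob P x = p x.
Proof.
pose P := image_law unit_law measurable_expansion.
have P1 i (B : set T) : P [set u | B (u i)] = (set_prob B)%:E.
  rewrite image_lawE -(unit_law_digit (pickle i)) -prE//.
  exact: measurable_digit.
exists P; split; last first.
  move=> x; rewrite /letter_prob /pr (P1 0 [set x]) /= /set_prob.
  rewrite (bigD1_seq x)//= asboolT// mul1r big1 ?addr0// => y /negP yx.
  by rewrite asboolF ?mul0r// => yE; apply: yx; apply/eqP.
split; first by move=> i j B _; rewrite !P1.
move=> l B ul _; rewrite image_lawE.
pose N := (\max_(i <- l) pickle i).+1.
(* the constraint on the digit of rank k, trivial at the ranks of no site of l *)
pose B' k := if [pick j : seq_sub l | pickle (val j) == k] is Some j
             then B (val j) else setT.
have B'P i : i \in l -> B' (pickle i) = B i.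
  move=> il; rewrite /B'; case: pickP => [j /eqP/(pcan_inj pickleK) -> //|].
  by move=> /(_ (SeqSub il)) /=; rewrite eqxx.
have B'T k : k \notin map pickle l -> B' k = setT.
  move=> kl; rewrite /B'; case: pickP => [j /eqP jk|//].
  by move/negP: kl; case; rewrite -jk map_f// ; case: (j).
have lN i : i \in l -> (pickle i < N)%N.
  by move=> il; rewrite ltnS; rewrite (leq_bigmax_seq _ il).
have -> : expansion @^-1` [set u | forall i, i \in l -> B i (u i)] =
    [set om | forall k, (k < N)%N -> B' k (digit (iter k rescale (clamp om)))].
  apply/seteqP; split => om /=.
    move=> Bom k kN; have [/mapP[i il ->]|/B'T -> //] := boolP (k \in map pickle l).
    by rewrite B'P//; exact: Bom.
  by move=> Bom i il; rewrite -(B'P _ il); exact: (Bom _ (lN _ il)).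
rewrite prE; last first.
  rewrite (_ : [set om | _] = \bigcap_(k in [set k | (k < N)%N])
    [set om | B' k (digit (iter k rescale (clamp om)))]).
    by apply: bigcap_measurable => [|k _]; [exists 0%N|exact: measurable_digit].
  by apply/seteqP; split => om /= H k /H.
rewrite unit_law_independent.
under [RHS]eq_bigr do rewrite P1.
rewrite prodEFin; congr EFin.
transitivity (\prod_(k <- map pickle l) set_prob (B' k)); last first.
  by rewrite big_map; apply: eq_big_seq => i il; rewrite B'P.
rewrite -(big_mkord xpredT (fun k => set_prob (B' k))).
rewrite (bigID (fun k => k \in map pickle l))/= [X in _ * X]big1 ?mulr1; last first.
  by move=> k /B'T ->; exact: set_probT.
rewrite -big_filter; apply: perm_big; apply: uniq_perm.
- by rewrite filter_uniq// iota_uniq.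
- by rewrite map_inj_uniq//; exact: (pcan_inj pickleK).
move=> k; rewrite mem_filter mem_index_iota/=.
have [/mapP[i il ->]|//] := boolP (k \in map pickle l).
by rewrite lN.
Qed.

End iid_existence.

(** * Finding the window numbers with a finite alphabet *)

(** A letter consists of an own part and a coin. The own part says what its site
    does: inl k follows the majority of window k + 1, inr (Some b) writes b, and
    inr None follows the majority of a window whose number exceeds N and remains
    to be found by means of the coins of later sites. *)
Definition letter (N : nat) := (('I_N + option bool) * bool)%type.

HB.instance Definition _ N := Finite.on (letter N).
HB.instance Definition _ N := isPointed.Build (letter N) (inr None, true).

Definition letters (N : nat) := g_sigma_algebraType [set: set (letter N)].

Lemma measurable_letters N (B : set (letters N)) : measurable B.
Proof. exact: sub_sigma_algebra. Qed.

Definition all_letters N : seq (letters N) := enum {: letter N}.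

Lemma all_letters_uniq N : uniq (all_letters N).
Proof. exact: enum_uniq. Qed.

Lemma mem_all_letters N (x : letters N) : x \in all_letters N.
Proof. exact: (mem_enum {: letter N} (x : letter N)). Qed.

(** inl k follows the majority of window k, and inr b writes b. *)
Definition instr := (nat + bool)%type.

(** A job is the search for the instruction of a site. In Pending h j, the search
    waits behind h more recent ones, and has established that the number of the
    window exceeds j. *)
Inductive job := Done of instr | Pending of nat & nat.

Definition pending (j : job) : bool := if j is Pending _ _ then true else false.

Section service.
Variable N : nat.

Definition overflow (o : 'I_N + option bool) : bool :=
  if o is inr None then true else false.

Definition start (o : 'I_N + option bool) : job :=
  match o with
  | inl k => Done (inl k.+1)
  | inr (Some b) => Done (inr b)
  | inr None => Pending 0 N
  end.

(** The searches form a stack. The coin of a new site goes to the top one: true ends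
    it, and false shows that its window number exceeds one more value. A job
    follows its own place only: it sees whether the top job leaves, and whether
    the new site adds one. Its outcome thus depends on later sites alone, and the
    stack needs no bottom. *)
Definition serve (st : job) (x : letter N) : job :=
  match st with
  | Done i => Done i
  | Pending 0 j => if x.2 then Done (inl j.+1) else Pending (overflow x.1) j.+1
  | Pending h.+1 j => Pending ((if x.2 then h else h.+1) + overflow x.1) j
  end.

Definition job_of (w : seq (letter N)) : job :=
  if w is x :: w' then foldl serve (start x.1) w' else Done (inr true).

Lemma job_of_rcons w x : w != [::] -> job_of (rcons w x) = serve (job_of w) x.
Proof. by case: w => //= y w _; rewrite foldl_rcons. Qed.

Lemma job_of_drop_rcons k w x : (k < size w)%N ->
  job_of (drop k (rcons w x)) = serve (job_of (drop k w)) x.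
Proof.
move=> kw; rewrite drop_rcons 1?ltnW// job_of_rcons//.
by rewrite -size_eq0 size_drop subn_eq0 -ltnNge.
Qed.

Lemma job_of_drop_last w x : job_of (drop (size w) (rcons w x)) = start x.1.
Proof. by rewrite drop_rcons// drop_size. Qed.

Lemma foldl_serve_Done i w : foldl serve (Done i) w = Done i.
Proof. by elim: w. Qed.

Lemma job_of_cat w v i : w != [::] -> job_of w = Done i -> job_of (w ++ v) = Done i.
Proof.
by case: w => //= y w _; rewrite foldl_cat => ->; exact: foldl_serve_Done.
Qed.

Lemma serve_Pending st x h j : serve st x = Pending h j ->
  exists h' j', st = Pending h' j' /\
    (h = (if x.2 then h'.-1 else h') + overflow x.1 /\ (x.2 -> 0 < h'))%N.
Proof.
case: st => [//|[|h'] j'] /=; case: ifP => // _ [<- _].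
- by exists 0%N, j'.
- by exists h'.+1, j'.
- by exists h'.+1, j'.
Qed.

(** Of two pending jobs the older one waits behind the younger one and behind
    everything that the younger one waits behind. *)
Lemma pending_stack w k k' h j h' j' : (k < k')%N -> (k' < size w)%N ->
  job_of (drop k w) = Pending h j -> job_of (drop k' w) = Pending h' j' ->
  (h' < h)%N.
Proof.
move=> kk'; elim/last_ind: w h j h' j' => [//|w x IH] h j h' j'.
rewrite size_rcons ltnS leq_eqVlt => /orP[/eqP k'w|k'w].
  rewrite job_of_drop_rcons -?k'w// k'w job_of_drop_last.
  move=> /serve_Pending[h1 [j1 [_ [-> h10]]]].
  case: (x.1) h10 => // -[//|] h10 /= [<- _].
  by rewrite addn1.
have kw := ltn_trans kk' k'w.
rewrite !job_of_drop_rcons//.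
move=> /serve_Pending[h1 [j1 [e1 [-> h10]]]] /serve_Pending[h2 [j2 [e2 [-> h20]]]].
have := IH _ _ _ _ k'w e1 e2.
by case: (x.2) h10 h20 => [/(_ isT)+ /(_ isT)|_ _]; lia.
Qed.

Lemma served_unique w k k' j j' : (k < size w)%N -> (k' < size w)%N ->
  job_of (drop k w) = Pending 0 j -> job_of (drop k' w) = Pending 0 j' -> k = k'.
Proof.
move=> kw k'w jk jk'; case: (ltngtP k k') => // kk'.
  by have := pending_stack kk' k'w jk jk'.
by have := pending_stack kk' kw jk' jk.
Qed.

End service.

(** Each coin serves at most one job and each own part starts at most one, so this
    is how the letter of a new site averages a product over the jobs. *)
Lemma sum_prod_one_active {R : realType} (X : eqType) (l : seq X) (q : X -> R)
    n (act : pred 'I_n) (A : 'I_n -> X -> R) (a : 'I_n -> R) :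
  \sum_(x <- l) q x = 1 ->
  (forall i, ~~ act i -> forall x, A i x = a i) ->
  (forall i, act i -> \sum_(x <- l) q x * A i x = a i) ->
  (forall i j, act i -> act j -> i = j) ->
  \sum_(x <- l) q x * \prod_i A i x = \prod_i a i.
Proof.
move=> q1 nact sact uact.
have [i0 ai0|noact] := pickP act; last first.
  transitivity (\sum_(x <- l) q x * \prod_i a i); last by rewrite -mulr_suml q1 mul1r.
  apply: eq_bigr => x _; congr (_ * _); apply: eq_bigr => i _.
  by apply: nact; rewrite noact.
rewrite (bigD1 i0)//= -(sact _ ai0) mulr_suml; apply: eq_bigr => x _.
rewrite -mulrA (bigD1 i0)//=; congr (_ * (_ * _)).
apply: eq_bigr => i ii0; apply: nact.
by apply: contraNN ii0 => ai; apply/eqP/uact.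
Qed.

Section letter_law.
Context {R : realType}.
Variables (eps r : R) (m : nat -> nat) (N : nat).
Hypothesis heps : 0 < eps < 1 / 2.
Hypothesis hr : 0 < r < 1.

Definition own_prob (o : 'I_N + option bool) : R :=
  match o with
  | inl k => (1 - 2 * eps) * ((1 - r) * r ^+ k)
  | inr (Some _) => eps
  | inr None => (1 - 2 * eps) * r ^+ N
  end.

Definition coin_prob (c : bool) : R := if c then 1 - r else r.

Definition letter_law (x : letters N) : R :=
  own_prob (x : letter N).1 * coin_prob (x : letter N).2.

Definition overflow_prob : R := (1 - 2 * eps) * r ^+ N.

Lemma sum_letters (V : nmodType) (F : letter N -> V) :
  \sum_(x <- all_letters N) F x =
  \sum_(o : 'I_N + option bool) \sum_(c : bool) F (o, c).
Proof.
rewrite pair_big /= /all_letters big_enum/=.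
by apply: eq_bigr => -[].
Qed.

Lemma sum_own (F : 'I_N + option bool -> R) :
  \sum_o F o = \sum_(k < N) F (inl k) + (F (inr None) + (F (inr (Some true)) + F (inr (Some false)))).
Proof.
rewrite big_sumType/=; congr (_ + _).
rewrite (bigD1 None)//= (bigD1 (Some true))//= (bigD1 (Some false))//=.
by rewrite big1 ?addr0// => -[[]|].
Qed.

Lemma own_prob_ge0 o : 0 <= own_prob o.
Proof.
have /andP[e0 e1] := heps; have /andP[r0 r1] := hr.
have e2 : 0 <= 1 - 2 * eps by lra.
case: o => [k|[b|]] /=; last by rewrite mulr_ge0// exprn_ge0// ltW.
  apply: mulr_ge0 => //; apply: mulr_ge0; first lra.
  exact/exprn_ge0/ltW.
exact: ltW.
Qed.

Lemma coin_prob_ge0 c : 0 <= coin_prob c.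
Proof. by have /andP[r0 r1] := hr; case: c => /=; lra. Qed.

Lemma letter_law_ge0 x : 0 <= letter_law x.
Proof. by rewrite mulr_ge0 ?own_prob_ge0 ?coin_prob_ge0. Qed.

Lemma sum_coin : \sum_(c : bool) coin_prob c = 1.
Proof. by rewrite big_bool /=; lra. Qed.

Lemma sum_geometric n : \sum_(k < n) (1 - r) * r ^+ k = 1 - r ^+ n.
Proof.
elim: n => [|n IH]; first by rewrite big_ord0 expr0 subrr.
by rewrite big_ord_recr/= IH exprS; ring.
Qed.

Lemma sum_own_prob : \sum_o own_prob o = 1.
Proof.
rewrite sum_own /= -mulr_sumr sum_geometric; ring.
Qed.

Lemma sum_letter_law : \sum_(x <- all_letters N) letter_law x = 1.
Proof.
rewrite sum_letters /letter_law /=.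
under eq_bigr do rewrite -mulr_sumr sum_coin mulr1.
exact: sum_own_prob.
Qed.

Definition update (i : instr) (y : nat -> bool) : bool :=
  match i with inl k => @majority R m k y | inr b => b end.

Section martingale.
Variables (n : nat) (y : nat -> nat -> bool) (v : nat -> bool).

(** The probability that the majority is v k in a window whose geometric number is
    conditioned to exceed j. *)
Definition tail_prob (k j : nat) : R :=
  if v k then maj_prob r m j (y k) else 1 - maj_prob r m j (y k).

(** The conditional probability that the instruction found by the job makes v k out
    of the past y k. *)
Definition success (k : nat) (st : job) : R :=
  match st with
  | Done i => (update i (y k) == v k)%:R
  | Pending _ j => tail_prob k j
  end.

Definition success_after_coin (k : nat) (st : job) (c : bool) : R :=
  match st with
  | Done i => (update i (y k) == v k)%:R
  | Pending 0 j => if c then (@majority R m j.+1 (y k) == v k)%:R else tail_prob k j.+1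
  | Pending _.+1 j => tail_prob k j
  end.

Lemma success_serve k st x : success k (serve st x) = success_after_coin k st (x : letter N).2.
Proof. by case: st => [i|[|h] j] //=; case: ifP. Qed.

Lemma tail_probS k j : tail_prob k j =
  (1 - r) * (@majority R m j.+1 (y k) == v k)%:R + r * tail_prob k j.+1.
Proof.
rewrite /tail_prob (maj_probS m hr j).
by case: (v k); case: majority => /=; ring.
Qed.

(** The window numbers up to j can be drawn at once: this is the role of the own
    part of a letter. *)
Lemma tail_prob_iter k j : tail_prob k 0 =
  \sum_(i < j) (1 - r) * r ^+ i * (@majority R m i.+1 (y k) == v k)%:R + r ^+ j * tail_prob k j.
Proof.
elim: j => [|j IH]; first by rewrite big_ord0 expr0 mul1r add0r.
by rewrite IH big_ord_recr/= [tail_prob k j]tail_probS exprS; ring.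
Qed.

Lemma sum_success_after_coin k st :
  \sum_(c : bool) coin_prob c * success_after_coin k st c = success k st.
Proof.
rewrite big_bool /=; case: st => [i|[|h] j] /=; [ring|rewrite [RHS]tail_probS; ring|ring].
Qed.

Lemma sum_success_start k :
  (forall j, (1 <= j)%N -> odd (m j)) ->
  \sum_o own_prob o * success k (start o) = BK_kernel eps r m (v k) (y k).
Proof.
move=> m_odd; have kE : BK_kernel eps r m (v k) (y k) =
    eps + (1 - 2 * eps) * tail_prob k 0.
  rewrite /BK_kernel /tail_prob (@BK_plusE R eps r m hr m_odd).
  by case: (v k); ring.
rewrite sum_own kE (tail_prob_iter k N) /= mulrDr mulr_sumr.
under eq_bigr => i _ do rewrite -mulrA.
set S := \sum_(i < N) _.
by case: (v k) => /=; ring.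
Qed.

Hypothesis m_odd : forall j : nat, (1 <= j)%N -> odd (m j).

Definition site_value (w : seq (letter N)) (k : nat) : R :=
  if (k < size w)%N then success k (job_of (drop k w))
  else BK_kernel eps r m (v k) (y k).

(** The conditional probability, given the letters of w, that the jobs of the first
    n sites all succeed: the jobs that have not started yet contribute the kernel. *)
Definition total_value (w : seq (letter N)) : R := \prod_(k < n) site_value w k.

(** The coin bears on the served job only and the own part on the starting job
    only; both averages are exact because the geometric distribution is
    memoryless. *)
Lemma total_value_step w :
  \sum_(x <- all_letters N) letter_law x * total_value (rcons w x) = total_value w.
Proof.
pose A (k : 'I_n) (c : bool) : R :=
  if (k < size w)%N then success_after_coin k (job_of (drop k w)) c else 1.
pose B (k : 'I_n) (o : 'I_N + option bool) : R :=
  if (k < size w)%N then 1 else if k == size w :> nat then success k (start o)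
  else BK_kernel eps r m (v k) (y k).
have AB o c : total_value (rcons w (o, c)) = (\prod_k A k c) * (\prod_k B k o).
  rewrite -big_split; apply: eq_bigr => k _.
  rewrite /site_value /A /B size_rcons ltnS /=.
  case: (ltngtP k (size w)) => [kw|kw|kw].
  - by rewrite job_of_drop_rcons// success_serve mulr1.
  - by rewrite mul1r.
  - by rewrite mul1r [X in drop X]kw job_of_drop_last.
rewrite sum_letters /letter_law /=.
transitivity ((\sum_c coin_prob c * \prod_k A k c) * (\sum_o own_prob o * \prod_k B k o)).
  rewrite mulrC mulr_suml; apply: eq_bigr => o _.
  by rewrite mulr_sumr; apply: eq_bigr => c _; rewrite AB; ring.
rewrite (@sum_prod_one_active _ _ _ _ _
  (fun k : 'I_n => (k < size w)%N && (if job_of (drop k w) is Pending 0 _ then true else false))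
  A (fun k => if (k < size w)%N then success k (job_of (drop k w)) else 1)).
- rewrite (@sum_prod_one_active _ _ _ _ _ (fun k : 'I_n => k == size w :> nat)
    B (fun k => if (k < size w)%N then 1 else BK_kernel eps r m (v k) (y k))).
  + rewrite -big_split; apply: eq_bigr => k _ /=; rewrite /site_value.
    by case: ifP => _; rewrite ?mulr1 ?mul1r.
  + exact: sum_own_prob.
  + by move=> i /negbTE iw o; rewrite /B iw.
  + move=> i /eqP iw; rewrite /B iw ltnn eqxx -iw; exact: sum_success_start.
  + by move=> i j /eqP iw /eqP jw; apply/val_inj; rewrite /= iw jw.
- exact: sum_coin.
- move=> i; rewrite /A; case: ifP => //= iw.
  by case: job_of => [//|[//|h] j].
- by move=> i /andP[iw _]; rewrite /A iw; exact: sum_success_after_coin.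
move=> i j /andP[iw +] /andP[jw +].
case ei : (job_of (drop i w)) => [//|[|//] hi] _.
case ej : (job_of (drop j w)) => [//|[|//] hj] _.
by apply/val_inj; exact: (served_unique iw jw ei ej).
Qed.

Lemma sum_total_value t :
  \sum_(w <- words (all_letters N) t) word_prob letter_law w * total_value w =
  \prod_(k < n) BK_kernel eps r m (v k) (y k).
Proof.
elim: t => [|t IH]; first by rewrite /= big_seq1 /word_prob big_nil mul1r.
rewrite sum_words_rcons -IH; apply: eq_bigr => w _.
rewrite -total_value_step mulr_sumr; apply: eq_bigr => x _.
by rewrite /word_prob -cats1 big_cat big_seq1/= cats1 mulrA.
Qed.

Lemma tail_prob_bounds k j : 0 <= tail_prob k j <= 1.
Proof.
by have := maj_prob_bounds m hr j (y k); rewrite /tail_prob; case: (v k); lra.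
Qed.

Lemma success_bounds k st : 0 <= success k st <= 1.
Proof.
by case: st => [i|h j] /=; [case: eqP => _ /=; lra|exact: tail_prob_bounds].
Qed.

Definition all_succeed (w : seq (letter N)) : bool :=
  [forall k : 'I_n, if job_of (drop k w) is Done i then update i (y k) == v k else false].

(** The conditional probability of success is the indicator of success as soon as
    the first n jobs are done. *)
Lemma total_value_sandwich w : (n <= size w)%N ->
  (all_succeed w)%:R <= total_value w <=
  (all_succeed w)%:R + \sum_(k < n) (pending (job_of (drop k w)))%:R.
Proof.
move=> nw; rewrite /total_value.
have sv (k : 'I_n) : site_value w k = success k (job_of (drop k w)).
  by rewrite /site_value (leq_trans (ltn_ord k) nw).
under eq_bigr do rewrite sv.
have P01 : 0 <= \prod_(k < n) success k (job_of (drop k w)) <= 1.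
  apply/andP; split; first by apply: prodr_ge0 => k _; case/andP: (success_bounds k (job_of (drop k w))).
  by apply: prodr_ile1 => k _; exact: success_bounds.
have S0 : 0 <= \sum_(k < n) (pending (job_of (drop k w)))%:R :> R by apply: sumr_ge0.
have [sw|/forallPn[k0 k0w]] := boolP (all_succeed w).
  rewrite big1 ?lexx/=; first by lra.
  by move=> k _; move/forallP: sw => /(_ k); case: job_of => //= i ->.
rewrite /= add0r; case/andP: P01 => -> P1 /=.
rewrite [leRHS](bigD1 k0)//=; set rest := \sum_(i < n | _) _.
have rest0 : 0 <= rest by apply: sumr_ge0.
move: k0w P1; rewrite (bigD1 k0)//=.
case: (job_of (drop k0 w)) => [i /= /negbTE ->|h j _] /=; first by rewrite mul0r; lra.
by lra.
Qed.

End martingale.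

(** Exponential in the height of the stack that ends with the given job, which
    counts itself: h.+1 jobs have to leave before it is done. *)
Definition stack_weight (st : job) : R := if st is Pending h _ then 2 ^+ h.+1 else 0.

(** One step multiplies the weight 2 ^+ h.+1 by 1 / 2 with probability 1 - r, when
    the top job leaves, and by 2 with probability overflow_prob, when a job
    arrives. *)
Definition decay : R := (1 + r) / 2 * (1 + overflow_prob).

Lemma sum_own_overflow (f : bool -> R) :
  \sum_o own_prob o * f (overflow o) = (1 - overflow_prob) * f false + overflow_prob * f true.
Proof.
have := sum_own_prob; rewrite !sum_own /= -mulr_suml -/overflow_prob.
set S := \sum_(k < N) _ => S1.
have -> : S = 1 - overflow_prob - eps - eps by lra.
by ring.
Qed.

Lemma stack_weight_serve st :
  \sum_(x <- all_letters N) letter_law x * stack_weight (serve st x) <=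
  decay * stack_weight st.
Proof.
have /andP[e0 e1] := heps; have /andP[r0 r1] := hr.
have q0 : 0 <= overflow_prob by exact: (own_prob_ge0 (inr None)).
rewrite sum_letters /letter_law /=.
case: st => [i|[|h] j] /=.
- by rewrite mulr0 big1// => o _; rewrite big1// => c _; rewrite mulr0.
- under eq_bigr => o _ do rewrite big_bool/= mulr0 add0r -mulrA.
  rewrite (sum_own_overflow (fun b => r * 2 ^+ (nat_of_bool b).+1)) /= /decay expr1 expr2.
  by nra.
under eq_bigr => o _ do rewrite big_bool/= -!mulrA -mulrDr.
rewrite (sum_own_overflow (fun b => (1 - r) * 2 ^+ (h + b).+1 + r * 2 ^+ (h.+1 + b).+1)).
rewrite /= !addn0 !addn1 /decay !exprS le_eqVlt; apply/orP; left; apply/eqP.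
by field.
Qed.

Lemma sum_stack_weight x t :
  \sum_(w <- words (all_letters N) t) word_prob letter_law w * stack_weight (job_of (x :: w))
  <= decay ^+ t * 2.
Proof.
have /andP[e0 e1] := heps; have /andP[r0 r1] := hr.
have q0 : 0 <= overflow_prob by exact: (own_prob_ge0 (inr None)).
have d0 : 0 <= decay by rewrite /decay mulr_ge0 ?divr_ge0 ?addr_ge0// ltW.
elim: t => [|t IH].
  rewrite /= big_seq1 /word_prob big_nil expr0 !mul1r.
  by case: (x.1) => [k|[b|]] //=; rewrite expr1.
rewrite sum_words_rcons exprS -mulrA; apply: le_trans (ler_wpM2l d0 IH).
rewrite mulr_sumr; apply: ler_sum => w _.
rewrite mulrCA; under eq_bigr => z _.
  rewrite (_ : word_prob _ _ = word_prob letter_law w * letter_law z); last first.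
    by rewrite /word_prob -cats1 big_cat big_seq1.
  rewrite -rcons_cons job_of_rcons// -mulrA; over.
rewrite -mulr_sumr; apply: ler_wpM2l; last exact: stack_weight_serve.
by apply: prodr_ge0 => z _; exact: letter_law_ge0.
Qed.

(** Jobs arrive more slowly than they are done, so a given job remains pending with
    an exponentially small probability. *)
Lemma sum_pending t :
  \sum_(w <- words (all_letters N) t.+1) word_prob letter_law w * (pending (job_of w))%:R
  <= decay ^+ t * 2.
Proof.
rewrite sum_wordsS.
apply: (@le_trans _ _ (\sum_(x <- all_letters N) letter_law x * (decay ^+ t * 2))); last first.
  by rewrite -mulr_suml sum_letter_law mul1r.
apply: ler_sum => x _.
apply: le_trans (ler_wpM2l (letter_law_ge0 x) (sum_stack_weight x t)).
rewrite mulr_sumr; apply: ler_sum => w _.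
rewrite /word_prob big_cons -mulrA; apply: ler_wpM2l; first exact: letter_law_ge0.
apply: ler_wpM2l; first by apply: prodr_ge0 => z _; exact: letter_law_ge0.
case: (job_of _) => //= h j; rewrite exprn_ege1//; lra.
Qed.

End letter_law.

(** Own parts that carry the window numbers up to a large N make requests as rare
    as needed. *)
Lemma exists_small_overflow {R : realType} (eps r : R) : 0 < eps < 1 / 2 ->
  0 < r < 1 -> exists N, decay eps r N < 1.
Proof.
move=> /andP[e0 e1] /andP[r0 r1].
have d0 : 0 < (1 - r) / 2 by lra.
have : r ^+ n @[n --> \oo] --> (0 : R) by apply: cvg_expr; rewrite ger0_norm// ltW.
move/cvgr0Pnorm_lt => /(_ _ d0) [N _ /(_ N (leqnn _))].
have rN : 0 <= r ^+ N by rewrite exprn_ge0// ltW.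
rewrite ger0_norm// => rNlt; exists N; rewrite /decay /overflow_prob.
have q : (1 - 2 * eps) * r ^+ N <= r ^+ N by rewrite ler_piMl//; lra.
by nra.
Qed.

(** * Independence of the instructions *)

Lemma countable_instr : countable [set: instr].
Proof. exact: countableP. Qed.

Lemma measurable_prop {d : measure_display} {T : measurableType d} (Q : Prop) :
  measurable [set _ : T | Q].
Proof.
have [q|q] := pselect Q.
  have -> : [set _ : T | Q] = setT by apply/seteqP; split.
  exact: measurableT.
have -> : [set _ : T | Q] = set0 by apply/seteqP; split.
exact: measurable0.
Qed.

Lemma le_cvg0 {R : realType} (x : R) (f : nat -> R) :
  f t @[t --> \oo] --> 0 -> (forall t, x <= f t) -> x <= 0.
Proof.
move=> f0 xf; rewrite -(cvg_lim _ f0)//; apply: limr_ge; last exact: nearW.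
by apply/cvg_ex; exists 0.
Qed.

Section instructions.
Context {R : realType}.
Variables (eps r : R) (m : nat -> nat) (N : nat).
Local Notation space := (prod_space int (letters N)).

(** A job that is never done, which happens with probability 0, yields an arbitrary
    instruction. *)
Definition inst (i : int) (u : int -> letters N) : instr :=
  xget (inr true) [set I | exists n, job_of (word i n.+1 u) = Done I].

Lemma word_neq0 (T : eqType) i n (u : int -> T) : word i n.+1 u != [::].
Proof. by rewrite wordS. Qed.

Lemma job_of_word_le i n n' (u : int -> letters N) I : (n <= n')%N ->
  job_of (word i n.+1 u) = Done I -> job_of (word i n'.+1 u) = Done I.
Proof.
move=> nn' nI; rewrite -(subnKC nn') -addSn word_cat.
by apply: job_of_cat => //; exact: word_neq0.
Qed.

Lemma inst_Done i n (u : int -> letters N) I : job_of (word i n.+1 u) = Done I -> inst i u = I.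
Proof.
move=> nI; rewrite /inst; case: xgetP => [I' _ [n' n'I]|noI]; last by exfalso; apply: (noI I); exists n.
have := job_of_word_le (leq_maxl n n') nI.
by rewrite (job_of_word_le (leq_maxr n n') n'I) => -[].
Qed.

Lemma inst_shiftZ i u : inst i (shiftZ u) = inst (i + 1) u.
Proof.
rewrite /inst; congr xget; apply/seteqP.
by split => I [n nI]; exists n; move: nI; rewrite word_shiftZ.
Qed.

Definition insts (a : int) (n : nat) (u : int -> letters N) : seq instr :=
  map (inst^~ u) (interval_from a n).

Lemma nth_insts a n u k : (k < n)%N ->
  nth (inr true) (insts a n u) k = inst (a + k%:Z) u.
Proof.
move=> kn; rewrite /insts /interval_from -map_comp (nth_map 0%N) ?size_iota//.
by rewrite nth_iota.
Qed.

Lemma measurable_letters_word a n (S : set (seq (letters N))) :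
  measurable ([set u | S (word a n u)] : set space).
Proof.
exact: (measurable_word (@mem_all_letters N) (@measurable_letters N)).
Qed.

Lemma measurable_inst i (S : set instr) :
  measurable ([set u | S (inst i u)] : set space).
Proof.
have -> : [set u | S (inst i u)] =
  \bigcup_n [set u | (fun w => exists2 I, job_of w = Done I & S I) (word i n.+1 u)] `|`
  ([set u : int -> letters N | S (inr true)] `&`
    \bigcap_n [set u | (fun w => pending (job_of w)) (word i n.+1 u)]).
  apply/seteqP; split => [u Su|u [[n _ [I nI SI]]|[Su up]]] /=.
  - have [[n [I nI]]|nodone] := pselect (exists n, exists I, job_of (word i n.+1 u) = Done I).
      by left; exists n => //; exists I => //; rewrite -(inst_Done nI).
    right; split.
      move: Su; rewrite /= /inst; case: xgetP => [I _ [n nI]|//].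
      by exfalso; apply: nodone; exists n, I.
    move=> n _; change (pending (job_of (word i n.+1 u))).
    case e : (job_of (word i n.+1 u)) => [I|//].
    by exfalso; apply: nodone; exists n, I.
  - by rewrite (inst_Done nI).
  - rewrite /inst; case: xgetP => [I _ [n nI]|//].
    have : pending (job_of (word i n.+1 u)) := up n Logic.I.
    by rewrite nI.
apply: measurableU.
  apply: bigcupT_measurable => n.
  exact: (measurable_letters_word i n.+1 (fun w => exists2 I, job_of w = Done I & S I)).
apply: measurableI; last first.
  apply: bigcapT_measurable => n.
  exact: (measurable_letters_word i n.+1 (fun w => pending (job_of w))).
exact: measurable_prop.
Qed.

Lemma measurable_insts a n (S : set (seq instr)) :
  measurable ([set u | S (insts a n u)] : set space).
Proof.
rewrite /insts; elim: (interval_from a n) S => [|i l IH] S /=.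
  exact: measurable_prop.
have -> : [set u | S (inst i u :: map (inst^~ u) l)] =
    \bigcup_I ([set u | [set I] (inst i u)] `&`
      [set u | [set s | S (I :: s)] (map (inst^~ u) l)]).
  apply/seteqP; split => [u Su|u [I _ [/= ->]]//].
  by exists (inst i u).
apply: countable_bigcupT_measurable; first exact: countable_instr.
by move=> I; apply: measurableI; [exact: measurable_inst|exact: IH].
Qed.

Hypothesis heps : 0 < eps < 1 / 2.
Hypothesis hr : 0 < r < 1.
Hypothesis m_odd : forall j : nat, (1 <= j)%N -> odd (m j).
Hypothesis decay_lt1 : decay eps r N < 1.
Variable P : probability space R.
Hypothesis P_iid : iid P.
Hypothesis P_law : letter_prob P = letter_law eps r (N:=N).

Lemma pr_letters_word a n (S : set (seq (letters N))) :
  pr P [set u | S (word a n u)] =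
  \sum_(w <- words (all_letters N) n) word_prob (letter_law eps r (N:=N)) w * (`[< S w >])%:R.
Proof.
rewrite (pr_word (@all_letters_uniq N) (@mem_all_letters N) (@measurable_letters N)).
apply: eq_big_seq => w; rewrite mem_words; last exact: mem_all_letters.
move=> /eqP wn; rewrite mulrC -P_law; congr (_ * _).
exact: (iid_word (@all_letters_uniq N) (@mem_all_letters N) (@measurable_letters N) P_iid).
Qed.

Lemma pr_pending a t :
  pr P [set u | pending (job_of (word a t.+1 u))] <= decay eps r N ^+ t * 2.
Proof.
rewrite (pr_letters_word a t.+1 (fun w => pending (job_of w))).
apply: le_trans (sum_pending N heps hr t).
by apply: ler_sum => w _; rewrite asboolb.
Qed.

Lemma decay_ge0 : 0 <= decay eps r N.
Proof.
have /andP[e0 e1] := heps; have /andP[r0 r1] := hr.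
have q0 : 0 <= overflow_prob eps r N by exact: (own_prob_ge0 heps hr (inr None : 'I_N + option bool)).
by rewrite /decay mulr_ge0 ?divr_ge0 ?addr_ge0// ltW.
Qed.

Lemma cvg_decay (c : R) : decay eps r N ^+ t * c @[t --> \oo] --> 0.
Proof.
rewrite -[X in _ --> X](mul0r c); apply: cvgMl.
by apply: cvg_expr; rewrite ger0_norm// decay_ge0.
Qed.

Definition completed (u : int -> letters N) :=
  forall i, exists n, exists I, job_of (word i n.+1 u) = Done I.

(** Countably many null sets, one for each site. *)
Lemma ae_completed : P.-negligible [set u | ~ completed u].
Proof.
(* an enumeration of the integers *)
pose f (n : nat) : int := if odd n then - (n./2)%:Z else (n./2)%:Z.
have fsurj i : exists n, f n = i.
  case: (intP i) => [|n|n]; first by exists 0%N.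
    by exists (n.+1).*2; rewrite /f odd_double doubleK.
  by exists (n.+1).*2.+1; rewrite /f /= odd_double /= uphalf_double.
pose F i := \bigcap_n [set u : space | (fun w => pending (job_of w)) (word i n.+1 u)].
have mF i : measurable (F i).
  apply: bigcapT_measurable => n.
  exact: (measurable_letters_word i n.+1 (fun w => pending (job_of w))).
have F0 i : P (F i) = 0%E.
  rewrite prE//; congr EFin; apply/eqP; rewrite eq_le pr_ge0 andbT.
  apply: (le_cvg0 (cvg_decay 2)) => t; apply: le_trans (pr_pending i t).
  apply: pr_le => //; first exact: (measurable_letters_word i t.+1 (fun w => pending (job_of w))).
  by move=> u /(_ t Logic.I).
have nF i : P.-negligible (F i) by exists (F i); split.
apply: (negligibleS _ (negligible_bigcup (fun n => nF (f n)))) => u /= ucomp.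
move/existsNP : ucomp => [i ui]; have [n fn] := fsurj i.
exists n => //; rewrite fn => t _; change (pending (job_of (word i t.+1 u))).
case e : (job_of (word i t.+1 u)) => [I|//].
by exfalso; apply: ui; exists t, I.
Qed.

(** The updates of n sites are independent and each follows the kernel. The
    probability of success has the expectation computed at time 0 at all later
    times, by the martingale property, and differs from the indicator of success
    only while some of the n jobs are pending, which becomes unlikely. *)
Lemma pr_updates a n (y : nat -> nat -> bool) (v : nat -> bool) :
  pr P [set u | forall k, (k < n)%N -> @update R m (inst (a + k%:Z) u) (y k) = v k] =
  \prod_(k < n) BK_kernel eps r m (v k) (y k).
Proof.
pose M := [set u : space | forall k, (k < n)%N -> @update R m (inst (a + k%:Z) u) (y k) = v k].
have mM : measurable M.
  have := measurable_insts a n [set s | forall k, (k < n)%N ->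
     @update R m (nth (inr true) s k) (y k) = v k].
  rewrite (_ : [set u | _] = M)//; apply/seteqP.
  by split => u /= H k kn; have := H k kn; rewrite nth_insts.
apply/eqP; rewrite -subr_eq0 -normr_le0.
set K := \prod_(k < n) _.
(* t steps are left after the last of the n sites *)
have key t : `|pr P M - K| <= decay eps r N ^+ t * (n%:R * 2).
  pose T := (n + t.+1)%N.
  pose S (w : seq (letters N)) : Prop := all_succeed (R:=R) m n y v w.
  pose D (k : nat) (w : seq (letters N)) : Prop := pending (job_of (drop k w)).
  have EH : K = \sum_(w <- words (all_letters N) T)
      word_prob (letter_law eps r (N:=N)) w * total_value eps r m n y v w.
    by rewrite sum_total_value.
  have ED : \sum_(w <- words (all_letters N) T) word_prob (letter_law eps r (N:=N)) w *
      (\sum_(k < n) (pending (job_of (drop k w)))%:R) <= decay eps r N ^+ t * (n%:R * 2).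
    under eq_bigr do rewrite mulr_sumr.
    rewrite exchange_big/= (_ : n%:R * 2 = \sum_(k < n) 2); last first.
      by rewrite sumr_const card_ord mulr_natl.
    rewrite mulr_sumr; apply: ler_sum => k _.
    have kn := ltn_ord k.
    have -> : \sum_(w <- words (all_letters N) T) word_prob (letter_law eps r (N:=N)) w *
       (pending (job_of (drop k w)))%:R = pr P [set u | pending (job_of (word (a + k%:Z) (T - k)%N u))].
      rewrite (_ : [set u | _] = [set u | D k (word a T u)]).
        by rewrite pr_letters_word; apply: eq_bigr => w _; rewrite /D asboolb.
      have Tk : T = (k + (T - k))%N by rewrite subnKC// (leq_trans (ltnW kn))// leq_addr.
      by apply/seteqP; split => u; rewrite /D /= [in word a _ _]Tk drop_word.
    have -> : (T - k)%N = (t + (n - k)).+1 by rewrite /T -addnBAC ?(ltnW kn)// addnS addnC.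
    apply: (le_trans (pr_pending _ _)); rewrite exprD -mulrA; apply: ler_wpM2l.
      by rewrite exprn_ge0// decay_ge0.
    by rewrite ler_piMl// exprn_ile1// ?decay_ge0// ltW.
  have ES : pr P [set u | S (word a T u)] =
      \sum_(w <- words (all_letters N) T) word_prob (letter_law eps r (N:=N)) w *
        (all_succeed (R:=R) m n y v w)%:R.
    by rewrite pr_letters_word; apply: eq_bigr => w _; rewrite /S asboolb.
  have wp0 w : 0 <= word_prob (letter_law eps r (N:=N)) w.
    by apply: prodr_ge0 => x _; exact: letter_law_ge0.
  have sand w : w \in words (all_letters N) T ->
      (all_succeed (R:=R) m n y v w)%:R <= total_value eps r m n y v w <=
      (all_succeed (R:=R) m n y v w)%:R + \sum_(k < n) (pending (job_of (drop k w)))%:R.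
    rewrite mem_words => [/eqP wT|]; last exact: mem_all_letters.
    by apply: total_value_sandwich => //; rewrite wT leq_addr.
  have SK : pr P [set u | S (word a T u)] <= K.
    rewrite ES EH !big_seq; apply: ler_sum => w wT; apply: ler_wpM2l => //.
    by case/andP: (sand w wT).
  have KS : K <= pr P [set u | S (word a T u)] + decay eps r N ^+ t * (n%:R * 2).
    apply: le_trans (lerD (lexx _) ED); rewrite ES EH -big_split !big_seq/=.
    apply: ler_sum => w wT; rewrite -mulrDr; apply: ler_wpM2l => //.
    by case/andP: (sand w wT).
  have jobk u (k : 'I_n) : job_of (drop k (word a T u)) = job_of (word (a + k%:Z) (T - k).-1.+1 u).
    have Tk : T = (k + (T - k))%N.
      by rewrite subnKC// (leq_trans (ltnW (ltn_ord k)))// leq_addr.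
    rewrite [in LHS]Tk drop_word prednK// subn_gt0.
    by rewrite (leq_trans (ltn_ord k))// leq_addr.
  have SM : [set u | S (word a T u)] `<=` M.
    move=> u /= /forallP Su k kn; have := Su (Ordinal kn).
    by rewrite jobk; case e : (job_of _) => [I|//]; rewrite (inst_Done e) => /eqP.
  pose E := [set u : space | (fun w => exists k : 'I_n, D k w) (word a T u)].
  have mE : measurable E by exact: measurable_letters_word.
  have MS : M `<=` [set u | S (word a T u)] `|` E.
    move=> u Mu; have [Eu|Eu] := pselect (E u); [by right|left].
    apply/forallP => k; have := Mu k (ltn_ord k); rewrite jobk.
    case e : (job_of _) => [I|h j]; first by rewrite (inst_Done e) => ->.
    by exfalso; apply: Eu; exists k; rewrite /D jobk e.
  have mS : measurable ([set u | S (word a T u)] : set space) by exact: measurable_letters_word.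
  have PE : pr P E <= decay eps r N ^+ t * (n%:R * 2).
    apply: le_trans ED; rewrite (pr_letters_word a T (fun w => exists k : 'I_n, D k w)).
    apply: ler_sum => w _.
    apply: ler_wpM2l => //; case: asboolP => [[k kw]|_]; last exact: sumr_ge0.
    rewrite (bigD1 k)//= kw lerDl; exact: sumr_ge0.
  have PM1 : pr P [set u | S (word a T u)] <= pr P M by exact: pr_le.
  have PM2 : pr P M <= pr P [set u | S (word a T u)] + pr P E.
    by apply: le_trans (pr_setU_le P mS mE); apply: pr_le => //; exact: measurableU.
  by rewrite ler_norml; apply/andP; split; lra.
exact: (le_cvg0 (cvg_decay _) key).
Qed.

End instructions.

(** * Monotone simulation from the past *)

Definition scons (b : bool) (y : nat -> bool) : nat -> bool :=
  fun n => if n is n'.+1 then y n' else b.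

Definition le_past (y y' : nat -> bool) := forall i, y i ==> y' i.

Section simulation.
Context {R : realType}.
Variables (m : nat -> nat).

Local Notation update := (@update R m).

Definition simulate (y : nat -> bool) (l : seq instr) : nat -> bool :=
  foldl (fun y I => scons (update I y) y) y l.

(** The symbols that simulate prepends to the past, oldest first. *)
Fixpoint outputs (y : nat -> bool) (l : seq instr) : seq bool :=
  if l is i :: l' then update i y :: outputs (scons (update i y) y) l' else [::].

Definition extend (y : nat -> bool) (v : seq bool) : nat -> bool :=
  foldl (fun y b => scons b y) y v.

Lemma size_outputs y l : size (outputs y l) = size l.
Proof. by elim: l y => //= I l IH y; rewrite IH. Qed.

Lemma simulate_outputs y l : simulate y l = extend y (outputs y l).
Proof. by elim: l y => //= I l IH y; rewrite -IH. Qed.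

Lemma outputs_rcons y l I :
  outputs y (rcons l I) = rcons (outputs y l) (update I (simulate y l)).
Proof. by elim: l y => //= J l IH y; rewrite IH. Qed.

Lemma simulate_rcons y l I :
  simulate y (rcons l I) = scons (update I (simulate y l)) (simulate y l).
Proof. by rewrite /simulate foldl_rcons. Qed.

(** The simulation produces v if and only if each instruction, applied to the past
    that v prescribes, yields the symbol that v prescribes; so the probability of
    v involves the instructions separately. *)
Lemma outputsP y l v : size v = size l ->
  outputs y l = v <-> forall k, (k < size l)%N ->
    update (nth (inr true) l k) (extend y (take k v)) = nth true v k.
Proof.
elim: l y v => [|I l IH] y [|b v]//= [vl].
have := IH (scons (update I y) y) v vl => {}IH; split.
  by move=> [<- vE] [_|k kl] //=; move/IH : vE; apply.
move=> H; have /= H0 := H 0%N isT.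
rewrite H0 in IH *; congr cons; apply/IH => k kl.
exact: (H k.+1).
Qed.

Lemma update_mono I y y' : le_past y y' -> update I y ==> update I y'.
Proof. by case: I => [k|b] yy' /=; [exact: majority_mono|exact: implybb]. Qed.

Lemma simulate_mono l y y' : le_past y y' -> le_past (simulate y l) (simulate y' l).
Proof.
elim: l y y' => [//|I l IH] y y' yy' /=; apply: IH => -[|i] //=.
exact: update_mono.
Qed.

Section runs.
Variable N : nat.
Local Notation space := (prod_space int (letters N)).

(** The past of time i in the simulation that starts from the constant past b at
    time i - n. *)
Definition run (b : bool) (i : int) (n : nat) (u : int -> letters N) : nat -> bool :=
  simulate (fun=> b) (insts (i - n%:Z) n u).

Lemma insts_rcons a n (u : int -> letters N) : insts a n.+1 u = rcons (insts a n u) (inst (a + n%:Z) u).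
Proof.
by rewrite /insts -addn1 interval_from_cat map_cat /interval_from /= addr0 cats1.
Qed.

Lemma insts_cons a n u : insts a n.+1 u = inst (N:=N) a u :: insts (a + 1) n u.
Proof.
by rewrite /insts -add1n interval_from_cat map_cat /interval_from /= addr0.
Qed.

Lemma run_next b i n u :
  run b (i + 1) n.+1 u = scons (update (inst i u) (run b i n u)) (run b i n u).
Proof.
rewrite /run (_ : i + 1 - n.+1%:Z = i - n%:Z); last lia.
by rewrite insts_rcons simulate_rcons (_ : i - n%:Z + n%:Z = i); last lia.
Qed.

Lemma run_shiftZ b i n u : run b i n (shiftZ u) = run b (i + 1) n u.
Proof.
rewrite /run (_ : i + 1 - n%:Z = i - n%:Z + 1); last lia.
congr simulate; rewrite /insts /interval_from -!map_comp; apply: eq_map => k /=.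
by rewrite inst_shiftZ; congr inst; lia.
Qed.

(** An earlier start from the constant past true is a start, at the present one,
    from a smaller past. *)
Lemma run_true_decr i n u : le_past (run true i n.+1 u) (run true i n u).
Proof.
rewrite /run insts_cons (_ : i - n.+1%:Z + 1 = i - n%:Z); last lia.
by rewrite /simulate /=; apply: simulate_mono => k; exact: implybT.
Qed.

Lemma run_false_incr i n u : le_past (run false i n u) (run false i n.+1 u).
Proof.
rewrite /run insts_cons (_ : i - n.+1%:Z + 1 = i - n%:Z); last lia.
by rewrite /simulate /=; apply: simulate_mono => k.
Qed.

Lemma run_false_true i n u : le_past (run false i n u) (run true i n u).
Proof. exact: simulate_mono. Qed.

Lemma run_true_le i n n' u k : (n <= n')%N -> run true i n' u k -> run true i n u k.
Proof.
move=> /subnKC <-; elim: (n' - n)%N => [|j IH]; first by rewrite addn0.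
by rewrite addnS => /(implyP (run_true_decr i (n + j) u k)) /IH.
Qed.

Lemma run_false_le i n n' u k : (n <= n')%N -> run false i n u k -> run false i n' u k.
Proof.
move=> /subnKC <-; elim: (n' - n)%N => [|j IH]; first by rewrite addn0.
by move=> /IH h; rewrite addnS; apply: (implyP (run_false_incr i (n + j) u k)).
Qed.

(** The limit, along starts that recede to the infinite past, of the symbol of site
    i in the simulations from the constant past b. These symbols are monotone in
    the start, so that the limit is an infimum or a supremum. *)
Definition limit_value (b : bool) (u : int -> letters N) (i : int) : bool :=
  if b then `[< forall n, run true (i + 1) n u 0%N >]
  else `[< exists n, run false (i + 1) n u 0%N >].

Lemma limit_value_eventually b u i :
  exists n0, forall n, (n0 <= n)%N -> run b (i + 1) n u 0%N = limit_value b u i.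
Proof.
case: b; rewrite /limit_value.
  case: asboolP => [H|/existsNP[n0 /negP nr]]; first by exists 0%N => n _; exact: H.
  by exists n0 => n n0n; apply/negbTE/(contraNN _ nr); exact: run_true_le.
case: asboolP => [[n0 r0]|H]; first by exists n0 => n n0n; exact: run_false_le r0.
by exists 0%N => n _; apply/negbTE/negP => rn; apply: H; exists n.
Qed.

Lemma limit_value_false_true u i : limit_value false u i ==> limit_value true u i.
Proof.
have [n0 H0] := limit_value_eventually false u i.
have [n1 H1] := limit_value_eventually true u i.
rewrite -(H0 (maxn n0 n1)) ?leq_maxl// -(H1 (maxn n0 n1)) ?leq_maxr//.
exact: run_false_true.
Qed.

Lemma limit_value_shiftZ b u : limit_value b (shiftZ u) = shiftZ (limit_value b u).
Proof.
apply/funext => i; rewrite /shiftZ /limit_value.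
by under eq_forall do rewrite run_shiftZ; under eq_exists do rewrite run_shiftZ.
Qed.

Lemma run_shift_index b i n u k : run b i (n + k) u k = run b (i - k%:Z) n u 0%N.
Proof.
elim: k i => [|k IH] i; first by rewrite addn0 subr0.
rewrite addnS -[i in LHS](subrK 1) run_next /= IH.
by congr run; lia.
Qed.

(** The coordinate k of the past of time i is the symbol of site i - k - 1. *)
Lemma run_eventually b u i k : exists n0, forall n, (n0 <= n)%N ->
  run b i n u k = limit_value b u (i - k.+1%:Z).
Proof.
have [n0 H] := limit_value_eventually b u (i - k.+1%:Z).
exists (n0 + k)%N => n n0n; have kn : (k <= n)%N by apply: leq_trans n0n; rewrite leq_addl.
rewrite -(subnK kn) run_shift_index -(H (n - k)%N); last by rewrite leq_subRL// addnC.
by congr run; lia.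
Qed.

Lemma run_eventually_prefix b u i K : exists n0, forall n, (n0 <= n)%N ->
  forall k, (k < K)%N -> run b i n u k = limit_value b u (i - k.+1%:Z).
Proof.
elim: K => [|K [n0 IH]]; first by exists 0%N.
have [n1 H] := run_eventually b u i K.
exists (maxn n0 n1) => n; rewrite geq_max => /andP[n0n n1n] k.
by rewrite ltnS leq_eqVlt => /orP[/eqP ->|]; [exact: H|exact: IH].
Qed.

Lemma measurable_run b i n (S : set (nat -> bool)) :
  measurable ([set u | S (run b i n u)] : set space).
Proof. exact: (measurable_insts _ _ [set l | S (simulate (fun=> b) l)]). Qed.

Lemma measurable_limit_value b : measurable_fun [set: space] (limit_value b : space -> config).
Proof.
apply: measurable_fun_coord => i B _.
have mL : measurable [set u : space | limit_value b u i].
  case: b; rewrite /limit_value.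
    rewrite (_ : [set u | _] = \bigcap_n [set u | run true (i + 1) n u 0%N]).
      apply: bigcapT_measurable => n.
      exact: (measurable_run true (i + 1) n [set y | y 0%N]).
    by apply/seteqP; split => u; [move=> /= /asboolP H n _; exact: H|
      move=> H /=; apply/asboolP => n; exact: (H n Logic.I)].
  rewrite (_ : [set u | _] = \bigcup_n [set u | run false (i + 1) n u 0%N]).
    apply: bigcupT_measurable => n.
    exact: (measurable_run false (i + 1) n [set y | y 0%N]).
  by apply/seteqP; split => u; [move=> /= /asboolP[n H]; exists n|
    move=> [n _ H] /=; apply/asboolP; exists n].
rewrite (_ : [set u | _] = ([set u : space | limit_value b u i] `&` [set _ | B true]) `|`
   (~` [set u : space | limit_value b u i] `&` [set _ | B false])).
  by apply: measurableU; apply: measurableI; [|exact: measurable_prop|exact: measurableC|exact: measurable_prop].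
apply/seteqP; split => u /=.
  by case e : (limit_value b u i) => Bu; [left|right].
by move=> [[-> //]|[/negP/negbTE -> //]].
Qed.

End runs.
End simulation.

(** * The extremal limit chains *)

Lemma bounded_cvg_integral {d : measure_display} {Om : measurableType d} {R : realType}
    (P : probability Om R) (f_ : nat -> Om -> R) (f : Om -> R) :
  (forall n, measurable_fun setT (f_ n)) -> measurable_fun setT f ->
  (forall u, f_ n u @[n --> \oo] --> f u) ->
  (forall n u, `|f_ n u| <= 1) ->
  (\int[P]_u (f_ n u)%:E @[n --> \oo] --> \int[P]_u (f u)%:E)%E.
Proof.
move=> mf_ mf f_f f_1.
have [//| | | | | _ _ H] := @dominated_convergence _ Om R P setT measurableT
  (fun n u => (f_ n u)%:E) (fun u => (f u)%:E) (cst 1%E).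
- by move=> n; apply/measurable_EFinP.
- exact/measurable_EFinP.
- by apply: aeW => u _; apply: cvg_EFin; [exact: nearW|exact: f_f].
- exact: finite_measure_integrable_cst.
- by apply: aeW => u n _; rewrite lee_fin.
exact: H.
Qed.

Section past_density.
Context {R : realType}.
Variables (nu : probability config R).

(** The proofs h0 and mh are arguments of the measure, from which its structure is
    inferred. *)
Definition past_density (h : config -> R) (h0 : forall x, 0 <= h x)
    (mh : measurable_fun setT h) : set past -> \bar R :=
  fun B => (\int[nu]_(x in past_of @^-1` B) (h x)%:E)%E.

Variables (h : config -> R) (h0 : forall x, 0 <= h x) (mh : measurable_fun setT h).

Let past_density0 : past_density h0 mh set0 = 0%E.
Proof. by rewrite /past_density preimage_set0 integral_set0. Qed.

Let past_density_ge0 B : (0 <= past_density h0 mh B)%E.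
Proof. by apply: integral_ge0 => x _; rewrite lee_fin. Qed.

Let past_density_sigma_additive : semi_sigma_additive (past_density h0 mh).
Proof.
move=> F mF tF mUF; rewrite /past_density preimage_bigcup.
have mpre B : measurable B -> measurable (past_of @^-1` B).
  by move=> mB; rewrite -[X in measurable X]setTI; exact: measurable_past_of.
apply: cvg_toP.
  apply: ereal_nondecreasing_is_cvgn => m n mn.
  apply: lee_sum_nneg_natr => // k _ _.
  by apply: integral_ge0 => x _; rewrite lee_fin.
rewrite ge0_integral_bigcup//=.
- by move=> k; exact: mpre.
- by apply: measurable_funTS; exact/measurable_EFinP.
- by move=> x _; rewrite lee_fin.
apply/trivIsetP => i j _ _ ij; rewrite -preimage_setI.
by move/trivIsetP : tF => /(_ _ _ _ _ ij) ->//; rewrite preimage_set0.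
Qed.

HB.instance Definition _ := isMeasure.Build _ _ _ (past_density h0 mh)
  past_density0 past_density_ge0 past_density_sigma_additive.

End past_density.

(** A conditional probability given the past need only be tested on the events that
    depend on a finite part of the past. *)
Lemma past_density_ext {R : realType} (nu : probability config R)
    (h g : config -> R) : (forall x, 0 <= h x) -> (forall x, 0 <= g x <= 1) ->
  measurable_fun setT h -> measurable_fun setT g ->
  (forall (l : seq nat) (Q : set (seq bool)),
    (\int[nu]_(x in past_of @^-1` [set y : nat -> bool | Q (map y l)]) (g x)%:E =
     \int[nu]_(x in past_of @^-1` [set y : nat -> bool | Q (map y l)]) (h x)%:E)%E) ->
  forall B : set past, measurable B ->
    (\int[nu]_(x in past_of @^-1` B) (g x)%:E = \int[nu]_(x in past_of @^-1` B) (h x)%:E)%E.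
Proof.
move=> h0 g01 mh mg hg B mB.
have g0 x : 0 <= g x by case/andP: (g01 x).
pose G : {measure set past -> \bar R} := past_density nu g0 mg.
pose H : {measure set past -> \bar R} := past_density nu h0 mh.
apply: (measure_trace_ext mem_bools measurable_bool_set (m1 := G) (m2 := H)) => //.
rewrite /G /= /past_density preimage_setT.
apply: (@le_lt_trans _ _ (\int[nu]_x (cst 1%E x))%E); last first.
  by rewrite integral_cst//= mul1e; exact: (le_lt_trans (probability_le1 nu measurableT) (ltry 1)).
apply: ge0_le_integral => //.
- by move=> x _; rewrite lee_fin.
- exact/measurable_EFinP.
- by move=> x _; rewrite lee_fin; case/andP: (g01 x).
Qed.

Section limit_chain.
Context {R : realType}.
Variables (eps r : R) (m : nat -> nat) (N : nat).
Local Notation space := (prod_space int (letters N)).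
Hypothesis heps : 0 < eps < 1 / 2.
Hypothesis hr : 0 < r < 1.
Hypothesis m_odd : forall j : nat, (1 <= j)%N -> odd (m j).
Hypothesis m_incr : forall i j : nat, (1 <= i)%N -> (i < j)%N -> (m i < m j)%N.
Hypothesis measurable_kernel : forall a, measurable_fun [set: past] (BK_kernel eps r m a).
Hypothesis decay_lt1 : decay eps r N < 1.
Variable P : probability space R.
Hypothesis P_iid : iid P.
Hypothesis P_law : letter_prob P = letter_law eps r (N:=N).

Local Notation update := (@update R m).
Local Notation outputs := (@outputs R m).
Local Notation run := (@run R m N).
Local Notation limit_value := (@limit_value R m N).
Local Notation K := (BK_kernel eps r m).

Lemma kernel_ge0 a y : 0 <= K a y.
Proof. by apply: le_trans (BK_kernel_ge heps hr m_odd a y); case/andP: heps => /ltW. Qed.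

Lemma kernel_le1 a y : K a y <= 1.
Proof. exact: BK_kernel_le1. Qed.

Lemma pr_outputs b a n v : size v = n ->
  pr P [set u | outputs (fun=> b) (insts a n u) = v] =
  \prod_(k < n) K (nth true v k) (extend (fun=> b) (take k v)).
Proof.
move=> vn; rewrite -(pr_updates heps hr m_odd decay_lt1 P_iid P_law a n
  (fun k => extend (fun=> b) (take k v)) (nth true v)).
congr pr; apply/seteqP.
have sz u : size (insts (N:=N) a n u) = n by rewrite !size_map size_iota.
split => u /=.
  move=> /outputsP; rewrite sz vn => /(_ erefl) H k kn.
  by rewrite -(@nth_insts N a n u k kn) H.
move=> H; apply/outputsP; first by rewrite sz.
by rewrite sz => k kn; rewrite nth_insts// H.
Qed.

Lemma pr_outputs_rcons b a n v c : size v = n ->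
  pr P [set u | outputs (fun=> b) (insts a n.+1 u) = rcons v c] =
  K c (extend (fun=> b) v) * pr P [set u | outputs (fun=> b) (insts a n u) = v].
Proof.
move=> vn; rewrite !pr_outputs ?size_rcons ?vn// big_ord_recr/= mulrC.
rewrite nth_rcons vn ltnn eqxx -cats1 take_size_cat//; congr (_ * _).
apply: eq_bigr => k _; rewrite nth_cat vn ltn_ord take_cat vn ltn_ord.
by [].
Qed.

Lemma measurable_outputs b a n (S : set (seq bool)) :
  measurable ([set u | S (outputs (fun=> b) (insts a n u))] : set space).
Proof. exact: (measurable_insts _ _ [set l | S (outputs (fun=> b) l)]). Qed.

Lemma outputs_in_words b a n (u : int -> letters N) :
  outputs (fun=> b) (insts a n u) \in words [:: true; false] n.
Proof.
rewrite mem_words; last exact: mem_bools.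
by rewrite size_outputs !size_map size_iota.
Qed.

(** The instruction of site 0 is independent of those that produce its simulated
    past. *)
Lemma run_compatible b n c (S : set (nat -> bool)) :
  ((pr P [set u | update (inst 0%Z u) (run b 0 n u) = c /\ S (run b 0 n u)])%:E =
  \int[P]_u ((`[< S (run b 0 n u) >])%:R * K c (run b 0 n u))%:E)%E.
Proof.
pose X n u := outputs (fun=> b) (insts (N:=N) (0 - n%:Z) n u).
pose X' u := outputs (fun=> b) (insts (N:=N) (0 - n%:Z) n.+1 u).
have ub : uniq [:: true; false] by [].
pose F (v : seq bool) := (`[< S (extend (fun=> b) v) >])%:R * K c (extend (fun=> b) v).
have runE u : run b 0 n u = extend (fun=> b) (X n u) by exact: simulate_outputs.
have X'E u : X' u = rcons (X n u) (update (inst 0%Z u) (run b 0 n u)).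
  by rewrite /X' insts_rcons outputs_rcons subrK.
under eq_integral do rewrite runE.
rewrite (integral_finite_valued P (l := words [:: true; false] n) (X := X n) (F := F)); last 4 first.
- exact: words_uniq.
- by move=> u; exact: outputs_in_words.
- by move=> v; rewrite mulr_ge0// kernel_ge0.
- by move=> w; exact: (measurable_outputs b _ n [set w]).
congr EFin.
pose S' : set (seq bool) := [set w | exists v, w = rcons v c /\ S (extend (fun=> b) v)].
rewrite (_ : [set u | _] = [set u | S' (X' u)]); last first.
  apply/seteqP; split => u /=; rewrite X'E.
    by move=> [uc Su]; exists (X n u); rewrite uc -runE.
  by move=> [v [/rcons_inj[<- <-] Sv]]; rewrite runE.
rewrite (pr_finite_valued P (l := words [:: true; false] n.+1) (X := X')); last 3 first.
- exact: words_uniq.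
- by move=> u; exact: outputs_in_words.
- by move=> w; exact: (measurable_outputs b _ n.+1 [set w]).
rewrite sum_words_rcons; apply: eq_big_seq => v.
rewrite mem_words; last exact: mem_bools.
move=> /eqP vn; rewrite (bigD1_seq c)//=; last by case: (c).
rewrite big1 => [|c' c'c]; last first.
  rewrite asboolF ?mul0r// => -[v' [/rcons_inj[_ cc'] _]].
  by rewrite cc' eqxx in c'c.
rewrite addr0 /F -mulrA -pr_outputs_rcons//; congr (_%:R * _).
congr nat_of_bool; apply/asboolP/asboolP => [[v' [/rcons_inj[<- _] //]]|Sv].
by exists v.
Qed.

Lemma run_prefix_cvg b (u : int -> letters N) L : exists n0, forall n, (n0 <= n)%N ->
  forall k, (k < L)%N -> run b 0 n u k = past_of (limit_value b u) k.
Proof.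
have [n0 H] := @run_eventually_prefix R m N b u 0 L; exists n0 => n n0n k kL.
by rewrite H// /past_of sub0r.
Qed.

Lemma run_trace_cvg b (u : int -> letters N) (l : seq nat) : exists n0,
  forall n, (n0 <= n)%N -> map (run b 0 n u) l = map (past_of (limit_value b u)) l.
Proof.
have [n0 H] := run_prefix_cvg b u (\max_(k <- l) k).+1; exists n0 => n n0n.
by apply/eq_in_map => k kl; apply: H => //; rewrite ltnS (leq_bigmax_seq _ kl).
Qed.

(** The kernel is a continuous function of the past. *)
Lemma kernel_run_cvg b c (u : int -> letters N) :
  K c (run b 0 n u) @[n --> \oo] --> K c (past_of (limit_value b u)).
Proof.
have /andP[r0 r1] := hr.
apply/cvgrPdist_lt => e e0.
have : r ^+ n.+1 @[n --> \oo] --> (0 : R).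
  by rewrite (cvg_shiftS (fun n => r ^+ n)); apply: cvg_expr; rewrite ger0_norm ?ltW.
move/cvgr0Pnorm_lt => /(_ e e0) [J _ /(_ J (leqnn _))].
rewrite ger0_norm ?exprn_ge0 ?ltW// => rJ.
have [n0 H] := run_prefix_cvg b u (m J.+1); exists n0 => // n /= n0n.
apply: le_lt_trans rJ; rewrite ler_norml lerBrDl lerBlDl [leRHS]addrC.
have A := BK_kernel_osc heps hr m_odd m_incr c (ltn0Sn J) (H n n0n).
have B := BK_kernel_osc heps hr m_odd m_incr c (ltn0Sn J) (fun k kJ => esym (H n n0n k kJ)).
by rewrite A lerBlDr addrC.
Qed.

Lemma measurable_fun_run b n (F : (nat -> bool) -> R) :
  measurable_fun [set: space] (fun u => F (run b 0 n u)).
Proof.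
move=> _ Y mY; rewrite setTI.
exact: (measurable_run m b 0 n [set y | Y (F y)]).
Qed.

Let mlim b := measurable_limit_value (R := R) m (N := N) b.

Lemma measurable_past_limit b : measurable_fun [set: space] (past_of \o limit_value b : space -> past).
Proof. exact: (measurableT_comp measurable_past_of (mlim b)). Qed.

Lemma measurable_limit_event b c (l : seq nat) (Q : set (seq bool)) :
  measurable [set u : space | Q (map (past_of (limit_value b u)) l)] /\
  measurable [set u : space | limit_value b u 0 = c /\
                              Q (map (past_of (limit_value b u)) l)].
Proof.
have mQ : measurable [set u : space | Q (map (past_of (limit_value b u)) l)].
  have := measurable_past_limit b measurableT (measurable_trace mem_bools measurable_bool_set l Q).
  by rewrite setTI.
split=> //; apply: measurableI => //.
have := mlim b measurableT (measurable_coord measurable_bool_set 0 [set c]).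
by rewrite setTI.
Qed.

Lemma cvg_near_cst_nat (f : nat -> R) (c : R) :
  (exists n0, forall n, (n0 <= n)%N -> f n = c) -> f n @[n --> \oo] --> c.
Proof.
by move=> [n0 H]; apply: cvg_near_cst; exists n0 => // n /= n0n; exact: H.
Qed.

(** Compatibility of the simulations passes to the limit by dominated convergence,
    since the kernel is continuous. *)
Lemma limit_compatible b c (l : seq nat) (Q : set (seq bool)) :
  ((pr P [set u | limit_value b u 0 = c /\ Q (map (past_of (limit_value b u)) l)])%:E =
  \int[P]_u ((`[< Q (map (past_of (limit_value b u)) l) >])%:R *
              K c (past_of (limit_value b u)))%:E)%E.
Proof.
pose S : set (nat -> bool) := [set y : nat -> bool | Q (map y l)].
have [mS mSc] := measurable_limit_event b c l Q.
have ind_cvg u : (`[< S (run b 0 n u) >])%:R @[n --> \oo] -->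
    ((`[< Q (map (past_of (limit_value b u)) l) >])%:R : R).
  apply: cvg_near_cst_nat; have [n0 H] := run_trace_cvg b u l.
  by exists n0 => n n0n; rewrite /S /= H.
have rhs := @bounded_cvg_integral _ _ R P
  (fun n u => (`[< S (run b 0 n u) >])%:R * K c (run b 0 n u))
  (fun u => (`[< Q (map (past_of (limit_value b u)) l) >])%:R * K c (past_of (limit_value b u))).
have lhs := @bounded_cvg_integral _ _ R P
  (fun n u => (`[< update (inst 0%Z u) (run b 0 n u) = c /\ S (run b 0 n u) >])%:R)
  (fun u => (`[< limit_value b u 0 = c /\ Q (map (past_of (limit_value b u)) l) >])%:R).
have b1 (p : bool) : `|p%:R| <= 1 :> R by case: p; rewrite ?normr1 ?normr0.
have mset n : measurable [set u : space | update (inst 0%Z u) (run b 0 n u) = c /\ S (run b 0 n u)].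
  have := @measurable_run R m N b (0 + 1) n.+1 [set y | y 0%N = c /\ S (fun k => y k.+1)].
  rewrite (_ : [set u | _] = [set u | update (inst 0%Z u) (run b 0 n u) = c /\ S (run b 0 n u)])//.
  by apply/seteqP; split => u /=; rewrite run_next.
have indE (A : set space) : measurable A ->
    (\int[P]_u ((`[< A u >])%:R)%:E = (pr P A)%:E)%E.
  by move=> mA; rewrite -prE// -[A in RHS]setIT -integral_indic.
rewrite -indE//.
have {}rhs : (\int[P]_u ((`[< S (run b 0 n u) >])%:R * K c (run b 0 n u))%:E @[n --> \oo] -->
   \int[P]_u ((`[< Q (map (past_of (limit_value b u)) l) >])%:R * K c (past_of (limit_value b u)))%:E)%E.
  apply: rhs.
  - by move=> n; exact: (measurable_fun_run b n (fun y => (`[< S y >])%:R * K c y)).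
  - apply: measurable_funM; first exact: (measurable_indic mS).
    exact: (measurableT_comp (measurable_kernel c) (measurable_past_limit b)).
  - by move=> u; apply: cvgM; [exact: ind_cvg|exact: kernel_run_cvg].
  - move=> n u; rewrite normrM mulr_ile1// ger0_norm ?kernel_ge0// kernel_le1//.
have {}lhs : (\int[P]_u ((`[< update (inst 0%Z u) (run b 0 n u) = c /\ S (run b 0 n u) >])%:R)%:E @[n --> \oo] -->
   \int[P]_u ((`[< limit_value b u 0 = c /\ Q (map (past_of (limit_value b u)) l) >])%:R)%:E)%E.
  apply: lhs => //.
  - by move=> n; exact: (measurable_indic (mset n)).
  - exact: (measurable_indic mSc).
  move=> u; apply: cvg_near_cst_nat; have [n0 H] := run_trace_cvg b u l.
  have [n1 H1] := @limit_value_eventually R m N b u 0.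
  exists (maxn n0 n1) => n; rewrite geq_max => /andP[n0n n1n].
  rewrite -(H1 n.+1) ?(leqW n1n)// run_next /=.
  by rewrite /S /= H.
have E : (fun n => \int[P]_u ((`[< update (inst 0%Z u) (run b 0 n u) = c /\ S (run b 0 n u) >])%:R)%:E)%E =
    (fun n => \int[P]_u ((`[< S (run b 0 n u) >])%:R * K c (run b 0 n u))%:E)%E.
  by apply/funext => n; rewrite -run_compatible -indE.
rewrite E in lhs.
exact: (cvg_unique (@ereal_hausdorff R) lhs rhs).
Qed.

Definition limit_law b : probability config R := image_law P (mlim b).

Lemma limit_law_stationary b : stationary (limit_law b).
Proof.
move=> B mB.
change (P (limit_value b @^-1` (@shiftZ bool @^-1` B)) = P (limit_value b @^-1` B)).
have -> : limit_value b @^-1` (@shiftZ bool @^-1` B) =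
    @shift_by (letters N) 1 @^-1` (limit_value b @^-1` B).
  by apply/seteqP; split => u /=; rewrite shift_by1 limit_value_shiftZ.
rewrite (iid_shift_by (@all_letters_uniq N) (@mem_all_letters N) (@measurable_letters N) P_iid)//.
by rewrite -[X in measurable X]setTI; exact: (mlim b).
Qed.

Lemma limit_law_compatible b : compatible K (limit_law b).
Proof.
move=> a; split; first exact: measurable_kernel.
have mA : measurable [set x : config | x 0 = a].
  exact: (measurable_coord measurable_bool_set 0 [set a]).
have mpre B : measurable B -> measurable (past_of @^-1` B).
  by move=> mB; rewrite -[X in measurable X]setTI; exact: measurable_past_of.
have mKp := measurableT_comp (measurable_kernel a) measurable_past_of.
move=> B mB.
transitivity (\int[limit_law b]_(x in past_of @^-1` B) (\1_[set x : config | x 0 = a] x)%:E)%E.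
  by rewrite integral_indic//; exact: mpre.
apply: past_density_ext => //.
- by move=> x; exact: kernel_ge0.
- by move=> x; rewrite indicE; case: (_ \in _); rewrite ?lexx ?ler01.
move=> {B mB} l Q.
pose B : set past := [set y : nat -> bool | Q (map y l)].
have mB : measurable B by exact: (measurable_trace mem_bools measurable_bool_set).
rewrite integral_indic//; last exact: mpre.
transitivity (P [set u | limit_value b u 0 = a /\
   Q (map (past_of (limit_value b u)) l)]); first by [].
rewrite prE; last by case: (measurable_limit_event b a l Q).
rewrite limit_compatible.
rewrite (ge0_integral_pushforward (mlim b)); last 3 first.
- exact: mpre.
- by apply/measurable_EFinP; apply: measurable_funTS.
- by move=> x _; rewrite lee_fin; exact: kernel_ge0.
rewrite [RHS]integral_mkcond; apply: eq_integral => u _.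
rewrite patchE; case: ifPn; rewrite ?inE /= => Bu.
  by rewrite asboolT// mul1r.
by rewrite asboolF ?mul0r// => Qu; move: Bu; rewrite notin_setE; apply.
Qed.

End limit_chain.

(** * The coding *)

Section least_window.
Context {d : measure_display} {U : measurableType d} (s : seq U).
Hypothesis s_all : forall t : U, t \in s.
Hypothesis mU : forall B : set U, measurable B.
Local Notation space := (prod_space int U).
Variable F : space -> bool.

(** Membership in determined n depends on the letters of the window only, so the
    least such n satisfies the measurability demanded of a coding length by
    construction. *)
Definition determined (n : nat) (u : space) : Prop :=
  forall v : space, (forall i, - n%:Z <= i <= n%:Z -> u i = v i) -> F u = F v.

Definition coding_length (u : space) : option nat :=
  match pselect (exists n, `[< determined n u >]) with
  | left ex => Some (ex_minn ex)
  | right _ => None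
  end.

Lemma coding_lengthP u k : coding_length u = Some k <->
  determined k u /\ forall j, (j < k)%N -> ~ determined j u.
Proof.
rewrite /coding_length; case: pselect => [ex|nex]; last first.
  by split => // -[Dk _]; exfalso; apply: nex; exists k; exact/asboolP.
case: ex_minnP => n /asboolP Dn nmin; split => [[<-]|[Dk kmin]].
  split => // j jn Dj; have := nmin j; rewrite asboolT// => /(_ isT).
  by rewrite leqNgt jn.
congr Some; apply/eqP; rewrite eqn_leq nmin ?asboolT//=.
by rewrite leqNgt; apply/negP => /kmin; exact.
Qed.

Lemma coding_length_None u : coding_length u = None -> forall n, ~ determined n u.
Proof.
rewrite /coding_length; case: pselect => // nex _ n Dn.
by apply: nex; exists n; apply/asboolP.
Qed.

Lemma determined_local n k (u v : space) : (n <= k)%N ->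
  (forall i, - k%:Z <= i <= k%:Z -> u i = v i) -> determined n u -> determined n v.
Proof.
move=> nk uv Du w vw.
rewrite -(Du v) ?(Du w)// => i ni; last by apply: uv; lia.
by rewrite uv ?vw//; lia.
Qed.

Lemma coding_length_window k l :
  <<s coord_events U (window (Some k) (Some l)) >>
    ([set u | coding_length u = Some k] `&` [set u | coding_length u = Some l]).
Proof.
have [<-|kl] := eqVneq k l; last first.
  rewrite (_ : _ `&` _ = set0); first exact: (@sigma_algebra0 _ setT).
  by apply/seteqP; split => u //= [-> [e]]; rewrite e eqxx in kl.
rewrite setIid.
pose A : set (seq U) := [set w | exists2 v : space,
  word (- k%:Z) (k + k).+1 v = w & coding_length v = Some k].
rewrite (_ : [set u | _] = [set u | A (word (- k%:Z) (k + k).+1 u)]).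
  apply: (measurable_trace_in s_all mU) => i.
  by rewrite mem_interval_from /window /=; lia.
apply/seteqP; split => u /=; first by exists u.
move=> [v vu /coding_lengthP[Dk kmin]]; apply/coding_lengthP.
have vuE i : - k%:Z <= i <= k%:Z -> v i = u i.
  by move=> ik; apply: (word_inj vu); lia.
split; first exact: (determined_local (leqnn k) vuE).
move=> j jk Dj; apply: (kmin j jk); apply: (determined_local (ltnW jk) _ Dj).
by move=> i ik; rewrite vuE.
Qed.

Lemma coding_length_determines u v :
  (forall i, window (coding_length u) (coding_length u) i -> u i = v i) -> F u = F v.
Proof.
case e : (coding_length u) => [k|] uv.
  by have /coding_lengthP[Dk _] := e; apply: Dk => i ik; apply: uv.
by congr F; apply/funext => i; exact: uv.
Qed.

End least_window.

Section coalescence.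
Context {R : realType}.
Variables (m : nat -> nat) (N : nat).
Local Notation space := (prod_space int (letters N)).
Local Notation limit_value := (@limit_value R m N).
Local Notation run := (@run R m N).

Lemma inst_determined i (u : int -> letters N) : completed u ->
  exists t : nat, forall v : int -> letters N,
    (forall j, i <= j <= i + t%:Z -> u j = v j) -> inst i v = inst i u.
Proof.
move=> /(_ i)[t [J tJ]]; exists t => v uv.
rewrite (inst_Done tJ); apply: (@inst_Done _ i t).
rewrite -tJ; congr job_of; apply: eq_word => j ij; symmetry; apply: uv; lia.
Qed.

Lemma insts_determined a n (u : int -> letters N) : completed u ->
  exists t : nat, forall v : int -> letters N,
    (forall j, - t%:Z <= j <= t%:Z -> u j = v j) -> insts a n v = insts a n u.
Proof.
move=> cu; have [t tP] := choice (fun i => inst_determined i cu).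
exists (`|a| + n + \max_(i <- interval_from a n) t i)%N => v uv.
apply/eq_in_map => i ian; apply: tP => j ij; apply: uv.
have : (t i <= \max_(i <- interval_from a n) t i)%N by rewrite (leq_bigmax_seq _ ian).
by move: ian; rewrite mem_interval_from; lia.
Qed.

(** When the two extremal simulations from a remote start agree at site 0, they
    squeeze the limit between them. They depend on finitely many instructions, and
    those on finitely many letters, so the squeeze persists for every sequence
    with the same letters. *)
Lemma coalescence_determines (u : space) : completed u ->
  limit_value true u 0 = limit_value false u 0 ->
  exists n, determined (fun v => limit_value true v 0) n u.
Proof.
move=> cu tf.
have [n0 H0] := @limit_value_eventually R m N true u 0.
have [n1 H1] := @limit_value_eventually R m N false u 0.
pose n := maxn n0 n1.
have {}H0 := H0 n (leq_maxl _ _); have {}H1 := H1 n (leq_maxr _ _).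
have [t tP] := insts_determined (0 + 1 - n%:Z) n cu; exists t => v uv.
have rv b : run b (0 + 1) n v 0%N = limit_value true u 0.
  by rewrite /run tP// -/(run b (0 + 1) n u); case: b; rewrite ?H0// H1 tf.
case e : (limit_value true u 0) rv => rv; last first.
  by apply/esym/negbTE/negP => /asboolP /(_ n); rewrite rv.
apply/esym; apply: (implyP (limit_value_false_true m v 0)).
by apply/asboolP; exists n; rewrite rv.
Qed.

End coalescence.

Section forward.
Context {R : realType}.
Variables (eps r : R) (m : nat -> nat).
Hypothesis heps : 0 < eps < 1 / 2.
Hypothesis hr : 0 < r < 1.
Hypothesis m_odd : forall j : nat, (1 <= j)%N -> odd (m j).
Hypothesis m_incr : forall i j : nat, (1 <= i)%N -> (i < j)%N -> (m i < m j)%N.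

(** Both extremal limits are compatible chains, so uniqueness gives them the same
    law. They are ordered pointwise, hence equal almost surely. *)
Lemma coding_from_uniqueness : unique_stationary_chain (BK_kernel eps r m) ->
  exists mu : probability config R,
    [/\ stationary mu, compatible (BK_kernel eps r m) mu &
        finitary_coding_of_finite_iid mu].
Proof.
move=> [mu [mu_st mu_comp mu_uniq]]; exists mu; split => //.
have mK a : measurable_fun [set: past] (BK_kernel eps r m a) by case: (mu_comp a).
have [N decN] := exists_small_overflow heps hr.
have [P [P_iid P_law]] := @iid_exists R _ (letters N) (all_letters N)
  (@all_letters_uniq N) (@mem_all_letters N)
  (letter_law eps r (N:=N)) (letter_law_ge0 heps hr) (sum_letter_law eps r N).
have {}P_law : letter_prob P = letter_law eps r (N:=N) by apply/funext.
pose nu b := limit_law m P b.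
have nu_mu b B : measurable B -> nu b B = mu B.
  apply: mu_uniq; first exact: limit_law_stationary.
  exact: (limit_law_compatible heps hr m_odd m_incr mK decN P_iid P_law).
pose X b (u : prod_space int (letters N)) := @limit_value R m N b u 0.
have mX b : measurable ([set u | X b u] : set (prod_space int (letters N))).
  have := measurable_limit_value (R := R) m (N := N) b measurableT
    (measurable_coord measurable_bool_set 0 [set c | c]).
  by rewrite setTI.
have PX b : P [set u | X b u] = mu [set x : config | x 0].
  rewrite -(nu_mu b)//; exact: (measurable_coord measurable_bool_set 0 [set c | c]).
have XFT u : X false u -> X true u.
  exact: (implyP (limit_value_false_true m u 0)).
have null : P.-negligible ([set u | X true u] `\` [set u | X false u]).
  exists ([set u | X true u] `\` [set u | X false u]); split => //.
    exact: measurableD.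
  have PD : P ([set u | X true u] `\` [set u | X false u]) =
      (P [set u | X true u] - P ([set u | X true u] `&` [set u | X false u]))%E.
    by apply: measureD => //; rewrite ltey_eq fin_num_measure.
  rewrite PD setIidr; last by move=> u; exact: XFT.
  by rewrite !PX subee// fin_num_measure//; exact: (measurable_coord measurable_bool_set 0 [set c | c]).
pose F (u : prod_space int (letters N)) := X true u.
have len_fin : {ae P, forall u, coding_length F u != None}.
  apply: (negligibleS _ (negligibleU null (ae_completed heps hr decN P_iid P_law))).
  move=> u /negP; rewrite negbK => /eqP e.
  have [cu|cu] := pselect (completed u); [left|by right].
  have XX : X true u <> X false u.
    move=> tf; have [n Dn] := coalescence_determines cu tf.
    exact: (coding_length_None e Dn).
  have XF : X false u = false by apply/negbTE/negP => f; apply: XX; rewrite f XFT.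
  have XT : X true u by apply: contrapT => /negP/negbTE t; apply: XX; rewrite t XF.
  by split; rewrite /mkset ?XF.
exists _, (letters N), P; split => //.
- rewrite (_ : [set: letters N] = [set` all_letters N]); first exact: finite_seq.
  by apply/seteqP; split => x //= _; exact: mem_all_letters.
- exact: measurable_letters.
exists (@limit_value R m N true), (coding_length F), (coding_length F); split => //.
- exact: measurable_limit_value.
- by move=> u; exact: limit_value_shiftZ.
- by move=> B mB; rewrite -(nu_mu true).
split; first by move=> k l; exact: (coding_length_window (@mem_all_letters N) (@measurable_letters N)).
exact: coding_length_determines.
Qed.

End forward.

Theorem theorem5 (R : realType) (eps r : R) (m : nat -> nat)
    (heps : 0 < eps < 1 / 2) (hr : 2 / 3 < r < 1)
    (m_odd : forall j : nat, (1 <= j)%N -> odd (m j))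
    (m_incr : forall i j : nat, (1 <= i)%N -> (i < j)%N -> (m i < m j)%N) :
  unique_stationary_chain (BK_kernel eps r m)
  <->
  exists mu : probability config R,
    [/\ stationary mu, compatible (BK_kernel eps r m) mu &
        finitary_coding_of_finite_iid mu].
Proof.
have hr' : 0 < r < 1 by lra.
split; first exact: coding_from_uniqueness.
move=> [mu [mu_st mu_comp mu_coding]]; exists mu; split => // nu nu_st nu_comp B mB.
exact: (unique_from_coding heps hr' m_odd m_incr mu_st mu_comp nu_st nu_comp mu_coding).
Qed.
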